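(* For each $N\in\mathbb{N}$ let $\{\sigma_j\}_{j=0}^N$ be a Rudin-Shapiro sequence and, for $k=0,\dots,N$, let $$P_{N,k}(z,w)=\frac{1}{\sqrt{N+1}}\sum_{j=0}^N\sigma_j\,e^{\frac{2\pi i jk}{N+1}}\,\frac{z^jw^{N-j}}{\left\|z^jw^{N-j}\right\|_{L^2(\mathbb{S}^3)}},\qquad (z,w)\in\mathbb{S}^3\subset\mathbb{C}^2 .$$ Let $f\in C^\infty(\mathbb{S}^3)$. Then for every choice of $k=k_N\in\{0,\dots,N\}$, $$\lim_{N\to\infty}\int_{\mathbb{S}^3}f\left|P_{N,k}\right|^2\,d\mathrm{Vol}=\int_{\mathbb{S}^3}f\,d\mathrm{Vol},$$ where $d\mathrm{Vol}$ is the Riemannian volume form on $\mathbb{S}^3$ normalized so that $\mathrm{Vol}(\mathbb{S}^3)=1$.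
   Context: **Sphere.** $\mathbb{S}^3=\{(z,w)\in\mathbb{C}^2:|z|^2+|w|^2=1\}$ with the round metric. In the Hopf coordinates $z=\sqrt{\rho}\,e^{i\theta_1}$, $w=\sqrt{1-\rho}\,e^{i\theta_2}$ with $\rho\in[0,1]$, $\theta_1,\theta_2\in[0,2\pi)$, the normalized volume is $d\mathrm{Vol}=\frac{1}{4\pi^2}\,d\rho\,d\theta_1\,d\theta_2$. The $L^2(\mathbb{S}^3)$ norm is taken with respect to $d\mathrm{Vol}$. **Rudin-Shapiro sequences.** Define trigonometric polynomials by $P_0=Q_0=1$ and, for $m\ge0$, $P_{m+1}(t)=P_m(t)+e^{i2^mt}Q_m(t)$, $Q_{m+1}(t)=P_m(t)-e^{i2^mt}Q_m(t)$. Then $P_m$ and $Q_m$ have the form $\sum_{j=0}^{2^m-1}\sigma_je^{ijt}$ with $\sigma_j\in\{\pm1\}$. A Rudin-Shapiro sequence $\{\sigma_j\}_{j=0}^N$ consists of the first $N+1$ coefficients of such a polynomial $P_m$ or $Q_m$, for some $m$ with $2^m\ge N+1$. (The coefficients of $P_m$ are the initial segment of those of $P_{m+1}$, so the $P_m$ define a single infinite sequence.) *)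

(* Defs.v *)
(* MathComp-Analysis, with R[i] from mathcomp-real-closed as the complex numbers. *)
From HB Require Import structures.
From mathcomp Require Import all_boot all_order all_algebra.
From mathcomp Require Import all_classical all_reals all_analysis.
From mathcomp Require Export complex.

Set Implicit Arguments.
Unset Strict Implicit.
Unset Printing Implicit Defensive.

Import Order.TTheory GRing.Theory Num.Theory.
Import numFieldNormedType.Exports.

Local Open Scope classical_set_scope.
Local Open Scope ring_scope.
Local Open Scope complex_scope.

Definition expi (R : realType) (t : R) : R[i] := cos t +i* sin t.

(** * Rudin-Shapiro sequences *)

(* The pair (P_m, Q_m) of functions of t. *)
Fixpoint RS_pair (R : realType) (m : nat) : (R -> R[i]) * (R -> R[i]) :=
  if m is m'.+1 then
    let: (P, Q) := RS_pair R m' in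
    (fun t => P t + expi ((2 ^ m')%:R * t) * Q t,
     fun t => P t - expi ((2 ^ m')%:R * t) * Q t)
  else (fun=> 1, fun=> 1).

Definition trig_coeffs (R : realType) (n : nat) (a : nat -> R)
    (T : R -> R[i]) : Prop :=
  forall t, T t = \sum_(0 <= j < n) (a j)%:C * expi (j%:R * t).

(* Only the values s 0, ..., s N matter. *)
Definition rudin_shapiro (R : realType) (N : nat) (s : nat -> R) : Prop :=
  exists m : nat, exists a : nat -> R,
    [/\ (N.+1 <= 2 ^ m)%N,
        trig_coeffs (2 ^ m) a (RS_pair R m).1 \/
        trig_coeffs (2 ^ m) a (RS_pair R m).2
      & forall j, (j <= N)%N -> s j = a j].

(** * The sphere and its normalized volume *)

Definition S3 (R : realType) : set (R[i] * R[i]) :=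
  [set p | `|p.1| ^+ 2 + `|p.2| ^+ 2 = 1].

Definition hopf (R : realType) (x : R * R * R) : R[i] * R[i] :=
  let: (rho, theta1, theta2) := x in
  ((Num.sqrt rho)%:C * expi theta1, (Num.sqrt (1 - rho))%:C * expi theta2).

Definition hopf_dom (R : realType) : set (R * R * R) :=
  `[0, 1]%classic `*` `[0, 2 * pi[%classic `*` `[0, 2 * pi[%classic.

(* Integration against dVol = (4 pi^2)^-1 drho dtheta1 dtheta2; it only sees
   the restriction of g to the sphere. *)
Definition S3_Rint (R : realType) (g : R[i] * R[i] -> R) : R :=
  (4 * pi ^+ 2)^-1 *
  \int[((@lebesgue_measure R \x @lebesgue_measure R) \x @lebesgue_measure R)%E]_(x in @hopf_dom R)
    g (hopf x).

Definition S3_int (R : realType) (g : R[i] * R[i] -> R[i]) : R[i] :=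
  S3_Rint (fun p => complex.Re (g p)) +i* S3_Rint (fun p => complex.Im (g p)).

Definition S3_L2norm (R : realType) (g : R[i] * R[i] -> R[i]) : R :=
  Num.sqrt (S3_Rint (fun p => ComplexField.Normc.normc (g p) ^+ 2)).

(** * Smooth functions on the sphere *)

(* C^n on the open set U: partial derivatives up to order n exist and are
   continuous on U. *)
Fixpoint Cn_on (R : realType) (d n : nat) (U : set 'rV[R]_d)
    (g : 'rV[R]_d -> R) : Prop :=
  (forall x, U x -> {for x, continuous g}) /\
  if n is n'.+1 then
    forall i : 'I_d,
      (forall x, U x -> derivable g x (delta_mx 0 i)) /\
      Cn_on n' U (fun x => 'D_(delta_mx 0 i) g x)
  else True.

Definition smooth_on (R : realType) (d : nat) (U : set 'rV[R]_d)
    (g : 'rV[R]_d -> R) : Prop := forall n, Cn_on n U g.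

Definition C2_of_R4 (R : realType) (x : 'rV[R]_4) : R[i] * R[i] :=
  (x 0 (inord 0) +i* x 0 (inord 1), x 0 (inord 2) +i* x 0 (inord 3)).

(* Near each point of S^3, f agrees on S^3 with a smooth function of the four
   real coordinates; the values of f off the sphere are irrelevant. *)
Definition smooth_S3 (R : realType) (f : R[i] * R[i] -> R[i]) : Prop :=
  forall p : 'rV[R]_4, S3 (C2_of_R4 p) ->
  exists U : set 'rV[R]_4, exists u v : 'rV[R]_4 -> R,
    [/\ open U, U p, smooth_on U u, smooth_on U v
      & forall x, U x -> S3 (C2_of_R4 x) -> f (C2_of_R4 x) = u x +i* v x].

(** * The polynomials P_{N,k} *)

Definition monom (R : realType) (N j : nat) (p : R[i] * R[i]) : R[i] :=
  p.1 ^+ j * p.2 ^+ (N - j).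

Definition PNk (R : realType) (N : nat) (s : nat -> R) (k : nat)
    (p : R[i] * R[i]) : R[i] :=
  (1 / Num.sqrt N.+1%:R)%:C *
  \sum_(0 <= j < N.+1)
    (s j)%:C * expi (2 * pi * j%:R * k%:R / N.+1%:R) *
    (monom N j p / (S3_L2norm (@monom R N j))%:C).

(* Main.v *)
(* Both sides are integrals against probability measures, so by density it is
   enough to test against f = z^a conj(z)^b w^c conj(w)^d; Bernstein polynomials
   in the four real coordinates give the density.  Expanding |P_{N,k}|^2 into
   products e_j conj(e_l) of normalized monomials, only the terms with
   j - l = b - a = c - d survive the integration over the angles, and the radial
   integrals are Beta integrals.

   If a = b and c = d, the diagonal terms sum up exactly to the integral of f, by
   the binomial theorem for (|z|^2 + |w|^2)^N = 1.  If b - a = m > 0, there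
   remains a sum of s_l s_{l+m} c_l / (N+1) up to a unimodular factor, where the
   weights c_l are bounded and unimodal in l.  By Abel summation it is
   at most a constant times max_n |\sum_(l < n) s_l s_{l+m}| / (N+1), and these
   partial autocorrelations are O_m(log N): the full autocorrelations of P_n and
   Q_n are opposite, so they remain bounded under the doubling recursion.  The
   case m < 0 follows by complex conjugation. *)
From HB Require Import structures.
Require Import Defs.
From mathcomp Require Import all_boot all_order all_algebra.
From mathcomp Require Import all_classical all_reals all_analysis.
From mathcomp Require Import measurable_realfun lebesgue_integral_fubini.
From mathcomp Require Import zify ring lra.
Import Order.TTheory GRing.Theory Num.Theory.
Import numFieldNormedType.Exports.
Local Open Scope classical_set_scope.
Local Open Scope ring_scope.
Local Open Scope complex_scope.

Set Implicit Arguments.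
Unset Strict Implicit.
Unset Printing Implicit Defensive.

(** Two obstacles shape the proof. The function f is given only on the sphere, while the nodes of a
    Bernstein grid fill the cube [-1, 1]^4. The value at a node is therefore taken at its radial
    projection, which is at most twice as far from any point of the sphere as the node itself.
    Continuity enters in the form |u(x) - u(y)| <= e + K |x - y|^2, because the average of such a
    bound under a binomial law is given exactly by its variance. The weights c_l contain square
    roots of factorials, but no asymptotics of factorials enter. The c_l are moments of products of
    two normalized monomials against a function bounded by 1, so the arithmetic-geometric mean
    inequality bounds them. The square of c_(l+1) / c_l is a rational function of l, so that
    unimodality becomes an inequality between natural numbers. *)

(** * Real and imaginary parts, conjugation, and the embedding of the reals *)

Section complex.
Context {R : realType}.
Implicit Types z w : R[i].

Lemma ReD z w : complex.Re (z + w) = complex.Re z + complex.Re w.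
Proof. by case: z w => ? ? []. Qed.

Lemma ImD z w : complex.Im (z + w) = complex.Im z + complex.Im w.
Proof. by case: z w => ? ? []. Qed.

Lemma ReM z w : complex.Re (z * w) =
  complex.Re z * complex.Re w - complex.Im z * complex.Im w.
Proof. by case: z w => ? ? []. Qed.

Lemma ImM z w : complex.Im (z * w) =
  complex.Re z * complex.Im w + complex.Im z * complex.Re w.
Proof. by case: z w => ? ? []. Qed.

Lemma Re_conj z : complex.Re z^*%C = complex.Re z.
Proof. by case: z. Qed.

Lemma Im_conj z : complex.Im z^*%C = - complex.Im z.
Proof. by case: z. Qed.

Lemma conjcM z w : (z * w)^*%C = z^*%C * w^*%C.
Proof. exact: rmorphM. Qed.

Lemma conjcX z n : (z ^+ n)^*%C = z^*%C ^+ n.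
Proof. exact: rmorphXn. Qed.

Lemma conjc_sum (I : Type) (r : seq I) (P : pred I) (F : I -> R[i]) :
  (\sum_(i <- r | P i) F i)^*%C = \sum_(i <- r | P i) (F i)^*%C.
Proof. exact: rmorph_sum. Qed.

Lemma realcM (a b : R) : (a * b)%:C = a%:C * b%:C.
Proof. exact: rmorphM. Qed.

Lemma realcV (a : R) : (a^-1)%:C = a%:C^-1.
Proof. exact: fmorphV. Qed.

Lemma realc_nat n : (n%:R : R)%:C = n%:R.
Proof. exact: rmorph_nat. Qed.

Lemma realcD (a b : R) : (a + b)%:C = a%:C + b%:C.
Proof. exact: rmorphD. Qed.

Lemma realcB (a b : R) : (a - b)%:C = a%:C - b%:C.
Proof. exact: rmorphB. Qed.

Lemma realcX (a : R) n : (a ^+ n)%:C = a%:C ^+ n.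
Proof. exact: rmorphXn. Qed.

Lemma norm_realc (a : R) : `|a%:C| = `|a|%:C.
Proof. by rewrite normc_def/= expr0n addr0 sqrtr_sqr. Qed.

End complex.

(** * Autocorrelation of Rudin-Shapiro sequences *)

Section expi.
Context {R : realType}.
Implicit Types t u : R.

Lemma expiD t u : expi (t + u) = expi t * expi u.
Proof.
by rewrite /expi cosD sinD; simpc; rewrite [X in _ +i* X]addrC.
Qed.

Lemma expi0 : expi (0 : R) = 1.
Proof. by rewrite /expi cos0 sin0. Qed.

Lemma expiX t n : expi t ^+ n = expi (n%:R * t).
Proof.
elim: n => [|n IHn]; first by rewrite expr0 mul0r expi0.
by rewrite exprS IHn -expiD -natr1 mulrDl mul1r addrC.
Qed.

Lemma norm_expi t : `|expi t| = 1 :> R[i].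
Proof. by rewrite normc_def/= cos2Dsin2 sqrtr1. Qed.

End expi.

Section rudin_shapiro.
Context {R : realType}.

(* The coefficients of (P_m, Q_m), extended by 0 beyond 2^m - 1. *)
Fixpoint rs_coeff (m : nat) : (nat -> R) * (nat -> R) :=
  if m is m'.+1 then
    let: (p, q) := rs_coeff m' in
    (fun j => if (j < 2 ^ m')%N then p j else q (j - 2 ^ m')%N,
     fun j => if (j < 2 ^ m')%N then p j else - q (j - 2 ^ m')%N)
  else (fun j => (j == 0)%:R, fun j => (j == 0)%:R).

Local Notation p m := (rs_coeff m).1.
Local Notation q m := (rs_coeff m).2.

Lemma rs_coeffS1 m j :
  p m.+1 j = if (j < 2 ^ m)%N then p m j else q m (j - 2 ^ m)%N.
Proof. by rewrite /=; case: (rs_coeff m). Qed.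

Lemma rs_coeffS2 m j :
  q m.+1 j = if (j < 2 ^ m)%N then p m j else - q m (j - 2 ^ m)%N.
Proof. by rewrite /=; case: (rs_coeff m). Qed.

Lemma rs_coeff_out m j : (2 ^ m <= j)%N -> p m j = 0 /\ q m j = 0.
Proof.
elim: m j => [|m IHm] j; first by case: j.
rewrite rs_coeffS1 rs_coeffS2 expnS => jm.
have [|_ ->] := IHm (j - 2 ^ m)%N; first by lia.
by rewrite oppr0 ltnNge (_ : 2 ^ m <= j)%N //; lia.
Qed.

Lemma rs_coeff_sq m j : (j < 2 ^ m)%N -> p m j ^+ 2 = 1 /\ q m j ^+ 2 = 1.
Proof.
elim: m j => [|m IHm] j; first by case: j => // _; rewrite expr1n.
rewrite rs_coeffS1 rs_coeffS2 expnS => jm.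
have [jlt|jge] := ltnP j (2 ^ m); first by have [-> _] := IHm _ jlt.
by rewrite sqrrN; have [|_ ->] := IHm (j - 2 ^ m)%N; first lia.
Qed.

Lemma rs_coeff_prefix m' m j : (m' < m)%N -> (j < 2 ^ m')%N ->
  p m j = p m' j /\ q m j = p m' j.
Proof.
elim: m => [//|m IHm]; rewrite ltnS leq_eqVlt => /predU1P[-> | m'm] jm.
  by rewrite rs_coeffS1 rs_coeffS2 jm.
have jm' : (j < 2 ^ m)%N by rewrite (leq_trans jm)// leq_exp2l// ltnW.
by rewrite rs_coeffS1 rs_coeffS2 jm'; have [-> _] := IHm m'm jm.
Qed.

Lemma rs_coeff_trig m : trig_coeffs (2 ^ m) (p m) (RS_pair R m).1 /\
  trig_coeffs (2 ^ m) (q m) (RS_pair R m).2.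
Proof.
elim: m => [|m [IHp IHq]].
  by split=> t; rewrite expn0 big_nat1/= mul0r expi0 mul1r.
(* [e] is the sign of the second half of the coefficients, 1 for P and -1 for Q. *)
have E (T : (nat -> R)) (e : R[i]) t :
    (forall j, (j < 2 ^ m)%N -> T j = p m j) ->
    (forall j, (T (j + 2 ^ m)%N)%:C = e * (q m j)%:C) ->
    \sum_(0 <= j < 2 ^ m.+1) (T j)%:C * expi (j%:R * t) =
    (RS_pair R m).1 t + e * expi ((2 ^ m)%:R * t) * (RS_pair R m).2 t.
  move=> Tp Tq; rewrite (big_cat_nat (n := 2 ^ m)) //=; last first.
    by rewrite leq_exp2l.
  rewrite IHp IHq; congr (_ + _).
    by rewrite !big_nat; apply: eq_bigr => j /Tp ->.
  rewrite -{1}[(2 ^ m)%N]add0n big_addn expnS mul2n -addnn addnK mulr_sumr.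
  apply: eq_bigr => j _; rewrite Tq natrD mulrDl expiD.
  by ring.
split=> t.
- rewrite (E _ 1) ?mul1r; first by rewrite /=; case: (RS_pair R m).
    by move=> j jm; rewrite rs_coeffS1 jm.
  by move=> j; rewrite rs_coeffS1 ltnNge leq_addl/= addnK mul1r.
- rewrite (E _ (-1)) ?mulN1r ?mulNr; first by rewrite /=; case: (RS_pair R m).
    by move=> j jm; rewrite rs_coeffS2 jm.
  by move=> j; rewrite rs_coeffS2 ltnNge leq_addl/= addnK mulN1r rmorphN.
Qed.

(* The difference of the two sums is a polynomial of degree less than [n] in
   e^(it), which vanishes at the [n] distinct points e^(ik/(n+1)), k < n. *)
Lemma trig_coeffs_inj n a b (T : R -> R[i]) :
  trig_coeffs n a T -> trig_coeffs n b T ->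
  forall j, (j < n)%N -> a j = b j.
Proof.
move=> Ta Tb j jn.
pose P : {poly R[i]} := \poly_(j < n) ((a j)%:C - (b j)%:C).
have P0 t : P.[expi t] = 0.
  rewrite horner_poly.
  rewrite (eq_bigr (fun i : 'I_n => (a i)%:C * expi (i%:R * t) -
    (b i)%:C * expi (i%:R * t))); last first.
    by move=> i _; rewrite expiX mulrBl.
  rewrite sumrB -(big_mkord xpredT (fun i => (a i)%:C * expi (i%:R * t))).
  rewrite -(big_mkord xpredT (fun i => (b i)%:C * expi (i%:R * t))).
  by rewrite -Ta -Tb subrr.
have : P = 0.
  pose rs := [seq expi (k%:R / n.+1%:R : R) | k <- iota 0 n].
  apply: (@roots_geq_poly_eq0 _ P rs).
  - by apply/allP => z /mapP[k _ ->]; rewrite /root P0.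
  - rewrite /rs map_inj_in_uniq ?iota_uniq// => k l.
    (* The angles k / (n+1) lie in [0, 1], inside [0, pi], where the cosine is injective; the real
       parts alone separate the points. *)
    have itv i : i \in iota 0 n -> (i%:R / n.+1%:R : R) \in `[0, pi].
      rewrite mem_iota add0n in_itv/= => iln.
      rewrite divr_ge0//= (@le_trans _ _ 1)//.
        by rewrite ler_pdivrMr// mul1r ler_nat; lia.
      by rewrite (le_trans _ (pi_ge2 R))// ler1n.
    move=> /itv ki /itv li [/(cos_inj ki li)] + _.
    move=> /(congr1 ( *%R^~ n.+1%:R)).
    by rewrite !divfK ?pnatr_eq0// => /eqP; rewrite eqr_nat => /eqP.
  - by rewrite size_map size_iota size_poly.
move=> /(congr1 (fun f : {poly R[i]} => f`_j)).
rewrite coef_poly jn coef0 => /eqP; rewrite subr_eq0 => /eqP.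
by case.
Qed.

(** Only the first index is confined to j < n; the second may run past n, so that a sum can be cut
    at 2^m without loss. *)
Definition corr (r : nat) (u : nat -> R) (n : nat) : R :=
  \sum_(0 <= j < n) u j * u (j + r)%N.

Definition rs_cross r m n : R :=
  \sum_(0 <= j < n)
    (if (2 ^ m <= j + r)%N then p m j * q m (j + r - 2 ^ m)%N else 0).

Lemma rs_coeff_le1 m j : `|p m j| <= 1 /\ `|q m j| <= 1.
Proof.
have sq1 (x : R) : x ^+ 2 = 1 -> `|x| <= 1.
  by move=> x1; rewrite -(@ler_pXn2r _ 2) ?nnegrE// expr1n -normrX x1 normr1.
have [/rs_coeff_sq[/sq1 p1 /sq1 q1]//|/rs_coeff_out[-> ->]] := ltnP j (2 ^ m).
by rewrite normr0 ler01.
Qed.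

(** A shift by r crosses the midpoint only from j >= 2^m - r, which leaves at most r summands, each
    of absolute value at most 1. *)
Lemma rs_cross_le r m n : (n <= 2 ^ m)%N -> `|rs_cross r m n| <= r%:R.
Proof.
move=> nm; apply: (le_trans (ler_norm_sum _ _ _)).
apply: (@le_trans _ _ (\sum_(0 <= j < n) (2 ^ m - r <= j)%N%:R)).
  apply: ler_sum => j _; case: ifPn => jr.
    rewrite (_ : (_ <= _)%N = true); last lia.
    by rewrite normrM mulr_ile1// ?(rs_coeff_le1 m _).1 ?(rs_coeff_le1 m _).2.
  by rewrite normr0 ler0n.
apply: (@le_trans _ _ (\sum_(0 <= j < 2 ^ m) (2 ^ m - r <= j)%N%:R)).
  by rewrite [leRHS](big_cat_nat (n := n))//= lerDl sumr_ge0.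
rewrite (big_cat_nat (n := 2 ^ m - r))//= ?leq_subr// big_nat big1 => [|j jm].
  rewrite add0r big_nat (eq_bigr (fun=> 1)) => [|j jm].
    rewrite -big_nat sumr_const_nat ler_nat; lia.
  by rewrite (andP jm).1.
by have -> : (2 ^ m - r <= j)%N = false by lia.
Qed.

(** As [p m] vanishes from 2^m on, its correlation omits exactly the pairs that cross into the
    second half. The second halves of P and Q are opposite, hence the two signs of the cross sum. *)
Lemma corr_rs_coeffS1 r m n : (n <= 2 ^ m)%N ->
  corr r (p m.+1) n = corr r (p m) n + rs_cross r m n /\
  corr r (q m.+1) n = corr r (p m) n - rs_cross r m n.
Proof.
move=> nm; rewrite /corr /rs_cross -big_split -sumrB /= !big_nat.
split; apply: eq_bigr => j jn; rewrite ?rs_coeffS1 ?rs_coeffS2.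
- rewrite (_ : (j < 2 ^ m)%N = true); last lia.
  case: ltnP => jr; first by rewrite addr0.
  by rewrite (rs_coeff_out jr).1 mulr0 add0r.
- rewrite (_ : (j < 2 ^ m)%N = true); last lia.
  case: ltnP => jr; first by rewrite subr0.
  by rewrite (rs_coeff_out jr).1 mulr0 add0r mulrN.
Qed.

(** Beyond 2^m both factors come from the second half, so the sign that distinguishes Q from P
    occurs twice and cancels. *)
Lemma corr_rs_coeffS2 r m n :
  corr r (p m.+1) (2 ^ m + n) = corr r (p m.+1) (2 ^ m) + corr r (q m) n /\
  corr r (q m.+1) (2 ^ m + n) = corr r (q m.+1) (2 ^ m) + corr r (q m) n.
Proof.
rewrite /corr.
split; rewrite (big_cat_nat (n := 2 ^ m)) ?leq_addr//=; congr (_ + _);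
  rewrite -{1}[(2 ^ m)%N]add0n big_addn addKn; apply: eq_bigr => j _;
  rewrite ?rs_coeffS1 ?rs_coeffS2 !ltnNge leq_addl/= addnK;
  rewrite (_ : (_ <= _)%N = true) ?mulrNN /=; try lia;
  by rewrite (_ : j + 2 ^ m + r - 2 ^ m = j + r)%N//; lia.
Qed.

(* Golay complementarity of the pair (P_m, Q_m). *)
Lemma corr_rs_coeff_compl r m : (0 < r)%N ->
  corr r (p m) (2 ^ m) + corr r (q m) (2 ^ m) = 0.
Proof.
move=> r0; elim: m => [|m IHm].
  by rewrite /corr expn0 !big_nat1 add0n /= (gtn_eqF r0) mulr0 addr0.
rewrite expnS mul2n -addnn !(corr_rs_coeffS2 _ _ _).1 !(corr_rs_coeffS2 _ _ _).2.
(* The cross sums of P and Q cancel; what is left is twice the sum one level below. *)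
rewrite (corr_rs_coeffS1 _ (leqnn _)).1 (corr_rs_coeffS1 _ (leqnn _)).2.
transitivity (2 * (corr r (p m) (2 ^ m) + corr r (q m) (2 ^ m))); first ring.
by rewrite IHm mulr0.
Qed.

(** By complementarity the correlations of the two halves cancel, and only the crossing pairs
    remain. The bound is therefore uniform in m. *)
Lemma corr_rs_coeff_full r m : (0 < r)%N ->
  `|corr r (p m) (2 ^ m)| <= r%:R /\ `|corr r (q m) (2 ^ m)| <= r%:R.
Proof.
move=> r0; suff: `|corr r (p m) (2 ^ m)| <= r%:R.
  have /eqP := corr_rs_coeff_compl m r0.
  by rewrite addr_eq0 => /eqP ->; rewrite normrN.
case: m => [|m].
  by rewrite /corr expn0 !big_nat1 add0n /= (gtn_eqF r0) mulr0 normr0.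
rewrite expnS mul2n -addnn (corr_rs_coeffS2 _ _ _).1.
rewrite (corr_rs_coeffS1 _ (leqnn _)).1 addrAC corr_rs_coeff_compl// add0r.
exact: rs_cross_le.
Qed.

(** Each doubling adds at most 2r. A cut-off in the first half costs one cross sum. A cut-off beyond
    it costs a full correlation and a cross sum, and leaves a shorter cut-off for Q_m. *)
Lemma corr_rs_coeff_le r m n : (0 < r)%N -> (n <= 2 ^ m)%N ->
  `|corr r (p m) n| <= (2 * r * m)%:R /\ `|corr r (q m) n| <= (2 * r * m)%:R.
Proof.
move=> r0; elim: m n => [|m IHm] n nm.
  have : corr r (p 0) n = 0 /\ corr r (q 0) n = 0.
    case: n nm => [|[|//]] _; first by rewrite /corr !big_geq.
    by rewrite /corr !big_nat1 add0n /= (gtn_eqF r0) mulr0.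
  by case=> p0 _; rewrite !p0 normr0.
have half k : (k <= 2 ^ m)%N ->
    `|corr r (p m.+1) k| <= `|corr r (p m) k| + r%:R /\
    `|corr r (q m.+1) k| <= `|corr r (p m) k| + r%:R.
  move=> km; have [-> ->] := corr_rs_coeffS1 r km.
  by split; [apply: (le_trans (ler_normD _ _)) | apply: (le_trans (ler_normB _ _))];
    rewrite lerD2l rs_cross_le.
have Er : (2 * r * m.+1)%:R = (2 * r * m)%:R + r%:R + r%:R :> R.
  by rewrite -!natrD; congr _%:R; lia.
have r_ge0 : 0 <= r%:R :> R by [].
have [nlt|nge] := leqP n (2 ^ m).
  have [h1 h2] := half _ nlt; have [h3 _] := IHm _ nlt.
  rewrite Er; split; lra.
have [h1 h2] := half _ (leqnn _); have [h3 _] := corr_rs_coeff_full m r0.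
have nE : n = (2 ^ m + (n - 2 ^ m))%N by lia.
have [|_ h4] := IHm (n - 2 ^ m)%N; first by move: nm; rewrite expnS; lia.
rewrite nE; have [-> ->] := corr_rs_coeffS2 r m (n - 2 ^ m).
rewrite Er; split; apply: (le_trans (ler_normD _ _)); lra.
Qed.

(** The witness is the least m with N + 1 <= 2^m, so that a bound linear in m is logarithmic in N.
    The exponent m0 of the given polynomial may be far larger, but P_m0 and Q_m0 both begin with P_m
    when m < m0. *)
Lemma rudin_shapiroP N s : rudin_shapiro N s -> exists m,
  [/\ (2 ^ m <= 2 * N.+1)%N,
      forall j, (j <= N)%N -> s j ^+ 2 = 1
    & forall r n, (0 < r)%N -> (n + r <= N.+1)%N ->
        `|corr r s n| <= (2 * r * m)%:R].
Proof.
move=> [m0 [a [Nm0 am0 sa]]].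
have {am0}am0 : (forall j, (j < 2 ^ m0)%N -> a j = p m0 j) \/
    (forall j, (j < 2 ^ m0)%N -> a j = q m0 j).
  have [tp tq] := rs_coeff_trig m0.
  by case: am0 => ha; [left|right]; exact: trig_coeffs_inj ha _.
have [m Nm mmin] : exists2 m, (N.+1 <= 2 ^ m)%N &
    forall m', (N.+1 <= 2 ^ m')%N -> (m <= m')%N.
  have e : exists m, (N.+1 <= 2 ^ m)%N by exists m0.
  by case: (ex_minnP e) => m; exists m.
have sE : (forall j, (j <= N)%N -> s j = p m j) \/
    (forall j, (j <= N)%N -> s j = q m j).
  have := mmin _ Nm0; rewrite leq_eqVlt => /predU1P[mE|mlt].
    move: am0; rewrite -mE => -[] aE; [left|right] => j jN;
      by rewrite sa// aE// (leq_trans _ Nm).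
  left=> j jN; have jm : (j < 2 ^ m)%N by rewrite (leq_trans _ Nm).
  rewrite sa//; have [E1 E2] := rs_coeff_prefix mlt jm.
  have jm0 : (j < 2 ^ m0)%N by rewrite (leq_trans _ Nm0).
  by case: am0 => ->.
exists m; split.
- case: m mmin {Nm sE} => [|m] mmin; first by lia.
  rewrite expnS leq_mul2l/= leqNgt; apply/negP => h.
  by have := mmin m (ltnW h); rewrite ltnn.
- move=> j jN; have jm : (j < 2 ^ m)%N by rewrite (leq_trans _ Nm).
  by case: sE => ->//; have [] := rs_coeff_sq jm.
- move=> r n r0 nr; have nm : (n <= 2 ^ m)%N by lia.
  have [c1 c2] := corr_rs_coeff_le r0 nm.
  have cE (u : nat -> R) : (forall j, (j <= N)%N -> s j = u j) ->
      corr r s n = corr r u n.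
    by move=> su; rewrite /corr !big_nat; apply: eq_bigr => j jn; rewrite !su//; lia.
  by case: sE => /cE ->.
Qed.

End rudin_shapiro.

(** * Summation by parts against unimodal weights *)

Section summation_by_parts.
Context {R : realType}.
Implicit Types (x e : nat -> R) (M S : R).

Lemma unimodal_variation x n M :
  (forall l, (l <= n)%N -> 0 <= x l <= M) ->
  (forall l, (l.+2 <= n)%N -> x l.+1 <= x l -> x l.+2 <= x l.+1) ->
  \sum_(0 <= l < n) `|x l.+1 - x l| <= 2 * M.
Proof.
move=> xM xuni.
(* Up to the peak the variation telescopes to x k - x 0 <= x k. Past a peak of height at most M it
   is at most M + (M - x k); the inequality with the predecessor records that the peak has been
   passed. *)
have key k : (k <= n)%N ->
    \sum_(0 <= l < k) `|x l.+1 - x l| <= x k \/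
    [/\ (0 < k)%N, x k <= x k.-1 &
        \sum_(0 <= l < k) `|x l.+1 - x l| <= 2 * M - x k].
  elim: k => [|k IHk] kn; first by left; rewrite big_geq//; case/andP: (xM 0%N kn).
  have /andP[k0 kM] := xM _ (ltnW kn); have /andP[k10 k1M] := xM _ kn.
  rewrite big_nat_recr//=; have [d|d] := lerP (x k) (x k.+1).
    case: (IHk (ltnW kn)) => [h|[kpos hk h]].
      by left; lra.
    have := xuni k.-1; rewrite (prednK kpos) => /(_ kn hk) d'.
    have -> : x k.+1 = x k by apply/eqP; rewrite eq_le d d'.
    by right; split=> //; rewrite subrr addr0.
  right; split=> //; first exact: ltW.
  by case: (IHk (ltnW kn)) => [h|[_ _ h]]; lra.
have /andP[n0 nM] := xM _ (leqnn n).
by case: (key n (leqnn n)) => [h|[_ _ h]]; lra.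
Qed.

Lemma summation_by_parts x e n :
  \sum_(0 <= l < n.+1) e l * x l =
  (\sum_(0 <= l < n.+1) e l) * x n -
  \sum_(0 <= k < n) (\sum_(0 <= l < k.+1) e l) * (x k.+1 - x k).
Proof.
elim: n => [|n IHn]; first by rewrite !big_nat1 big_geq// subr0.
rewrite big_nat_recr//= IHn [in RHS]big_nat_recr//= [X in _ = _ - X]big_nat_recr//=.
by ring.
Qed.

Lemma unimodal_sum_le x e n M S :
  (forall l, (l <= n)%N -> 0 <= x l <= M) ->
  (forall l, (l.+2 <= n)%N -> x l.+1 <= x l -> x l.+2 <= x l.+1) ->
  (forall k, (k <= n.+1)%N -> `|\sum_(0 <= l < k) e l| <= S) ->
  `|\sum_(0 <= l < n.+1) e l * x l| <= 3 * (S * M).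
Proof.
move=> xM xuni eS; rewrite summation_by_parts.
have /andP[n0 nM] := xM _ (leqnn n).
have S0 : 0 <= S by rewrite (le_trans _ (eS 0%N _)).
apply: (le_trans (ler_normB _ _)).
have -> : 3 * (S * M) = S * M + S * (2 * M) by ring.
apply: lerD; first by rewrite normrM ler_pM// ?eS// ger0_norm.
apply: (le_trans (ler_norm_sum _ _ _)).
apply: (@le_trans _ _ (\sum_(0 <= k < n) S * `|x k.+1 - x k|)).
  rewrite big_nat [leRHS]big_nat; apply: ler_sum => k kn.
  by rewrite normrM ler_wpM2r// eS//; lia.
by rewrite -mulr_sumr ler_wpM2l// unimodal_variation.
Qed.

End summation_by_parts.

(** * Unimodality of the moment weights *)

Section weights.
Context {R : realType}.

Definition monom_sqnorm N j : R := (j`! * (N - j)`!)%:R / N.+1`!%:R.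

(* The integral of z^(b-m) conj(z)^b w^(d+m) conj(w)^d e_(l+m) conj(e_l), where
   e_j is the normalized monomial proportional to z^j w^(N-j). *)
Definition monom_weight b d N m l : R :=
  ((b + l)`! * (d + (N - l))`!)%:R / (b + d + N).+1`!%:R /
  (Num.sqrt (monom_sqnorm N l) * Num.sqrt (monom_sqnorm N (l + m))).

Lemma fact_natr_gt0 n : 0 < n`!%:R :> R.
Proof. by rewrite ltr0n fact_gt0. Qed.

Lemma monom_sqnorm_gt0 N j : 0 < monom_sqnorm N j.
Proof. by rewrite divr_gt0 ?fact_natr_gt0// natrM mulr_gt0 ?fact_natr_gt0. Qed.

Lemma monom_weight_gt0 b d N m l : 0 < monom_weight b d N m l.
Proof.
apply: divr_gt0; last by rewrite mulr_gt0// sqrtr_gt0 monom_sqnorm_gt0.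
by rewrite divr_gt0 ?fact_natr_gt0// natrM mulr_gt0 ?fact_natr_gt0.
Qed.

Lemma monom_sqnormS N j : (j < N)%N ->
  monom_sqnorm N j.+1 * (N - j)%:R = monom_sqnorm N j * j.+1%:R.
Proof.
move=> jN; rewrite /monom_sqnorm mulrAC [RHS]mulrAC -!natrM; congr (_%:R / _).
by rewrite factS -(subnSK jN) [in RHS]factS; lia.
Qed.

(** Squaring removes the roots of the norms; this is the ratio of consecutive weights, cleared of
    denominators. *)
Lemma monom_weightS_sq b d N m l : (l + m < N)%N ->
  monom_weight b d N m l.+1 ^+ 2 *
    (l.+1 * (l + m).+1 * (d + (N - l)) ^ 2)%:R =
  monom_weight b d N m l ^+ 2 *
    ((b + l).+1 ^ 2 * (N - l) * (N - (l + m)))%:R.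
Proof.
move=> lN; have lN' : (l < N)%N by lia.
have fS1 : ((b + l.+1)`!%:R = (b + l).+1%:R * (b + l)`!%:R :> R).
  by rewrite addnS factS natrM.
have fS2 : ((d + (N - l))`!%:R = (d + (N - l))%:R * (d + (N - l.+1))`!%:R :> R).
  by rewrite -(subnSK lN') addnS factS natrM.
have sqE j : Num.sqrt (monom_sqnorm N j) ^+ 2 = monom_sqnorm N j.
  by rewrite sqr_sqrtr// ltW// monom_sqnorm_gt0.
have := monom_sqnormS lN'; have := monom_sqnormS lN.
rewrite /monom_weight; move: (fact_natr_gt0 (b + d + N).+1).
move: ((b + d + N).+1`!%:R) => F F0.
rewrite addSn !expr_div_n !exprMn !sqE !natrM fS1 fS2.
rewrite ?natrX.
move: (monom_sqnorm_gt0 N l) (monom_sqnorm_gt0 N (l + m))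
  (monom_sqnorm_gt0 N l.+1) (monom_sqnorm_gt0 N (l + m).+1).
move: (monom_sqnorm N l) (monom_sqnorm N (l + m)) (monom_sqnorm N l.+1)
  (monom_sqnorm N (l + m).+1) => u0 u1 u2 u3.
set p := (N - (l + m))%:R; set q := (N - l)%:R.
move=> u00 u10 u20 u30 E1 E2.
have p0 : 0 < p :> R by rewrite ltr0n; lia.
have q0 : 0 < q :> R by rewrite ltr0n; lia.
have -> : u3 = u1 * (l + m).+1%:R / p by rewrite -E1 mulfK// gt_eqF.
have -> : u2 = u0 * l.+1%:R / q by rewrite -E2 mulfK// gt_eqF.
clearbody p q; field.
by rewrite -natrD !nat1r !pnatr_eq0 !gt_eqF.
Qed.

(** With x = l + 1 and y = N - l, the hypothesis says that the weights do not increase from l to l +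
    1, the conclusion that they do not from l + 1 to l + 2. The reason is that (b + x)^2 / (x (x +
    m)) is nonincreasing in x, thanks to m <= b, and y (y - m) / (d + y)^2 is nondecreasing in y. *)
Lemma monom_ratio_decr b d m x y : (m <= b)%N -> (m < y)%N ->
  ((b + x) ^ 2 * y * (y - m) <= x * (x + m) * (d + y) ^ 2)%N ->
  ((b + x.+1) ^ 2 * y.-1 * (y.-1 - m) <= x.+1 * (x.+1 + m) * (d + y.-1) ^ 2)%N.
Proof.
case: y => [//|y] mb my h /=.
case: x h => [|x] h.
  (* For x = 0 the right-hand side vanishes, which forces b = 0 and then m = 0. *)
  have b0 : b = 0%N.
    case: (posnP b) => // b_gt0; move: h.
    by rewrite addn0 !mul0n leqNgt !muln_gt0 ?expn_gt0 b_gt0/= subn_gt0 my.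
  move: mb; rewrite b0 leqn0 => /eqP ->.
  rewrite add0n subn0 exp1n addn0 !mul1n -mulnn.
  by apply: leq_mul; lia.
(* That is, u / v <= (u + 1) / (v + 1); it is applied to each linear factor of the two quotients. *)
have SM u v : (u <= v)%N -> (v.+1 * u <= v * u.+1)%N.
  by move=> uv; rewrite mulSn mulnS leq_add2r.
have F1 : (((b + x.+2) * x.+1) * ((b + x.+2) * (x.+1 + m)) <=
    ((b + x.+1) * x.+2) * ((b + x.+1) * (x.+2 + m)))%N.
  rewrite (addnS b) (addSn x.+1); apply: leq_mul; apply: SM.
    exact: leq_addl.
  by rewrite addnC leq_add2r.
have F2 : ((y * (d + y.+1)) * ((y - m) * (d + y.+1)) <=
    (y.+1 * (d + y)) * ((y.+1 - m) * (d + y)))%N.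
  rewrite (subSn (my : (m <= y)%N)) addnS ![(_ * (d + y).+1)%N]mulnC.
  rewrite ![(_.+1 * (d + y))%N]mulnC.
  apply: leq_mul; apply: SM; first exact: leq_addl.
  by rewrite (leq_trans (leq_subr _ _))// leq_addl.
(* The product of [F1], [F2] and [h] is the goal multiplied by two positive factors, which are
   cancelled. *)
rewrite -(@leq_pmul2l (x.+1 * (x.+1 + m) * (d + y.+1) ^ 2)); last first.
  by rewrite !muln_gt0 ?expn_gt0 addnS.
have := leq_mul (leq_mul F1 F2) h.
have pos : (0 < (b + x.+1) ^ 2 * y.+1 * (y.+1 - m))%N.
  by rewrite !muln_gt0 ?expn_gt0 addnS subn_gt0 my.
move: pos h F1 F2; set A := (b + x.+1)%N; set B := (b + x.+2)%N.
set C := (y.+1 - m)%N; set D := (y - m)%N; set E := (d + y.+1)%N; set F := (d + y)%N.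
set X1 := (x.+1 + m)%N; set X2 := (x.+2 + m)%N.
move=> pos _ _ _ H.
rewrite -(@leq_pmul2l (A ^ 2 * y.+1 * C))//.
apply: leq_trans (leq_trans H _); rewrite -!mulnn; apply/eq_leq; lia.
Qed.

Lemma monom_weight_unimodal b d N m l : (m <= b)%N -> (l.+2 + m <= N)%N ->
  monom_weight b d N m l.+1 <= monom_weight b d N m l ->
  monom_weight b d N m l.+2 <= monom_weight b d N m l.+1.
Proof.
move=> mb lN.
have ratio k : (k + m < N)%N ->
    (monom_weight b d N m k.+1 <= monom_weight b d N m k) =
    ((b + k).+1 ^ 2 * (N - k) * (N - (k + m)) <=
     k.+1 * (k + m).+1 * (d + (N - k)) ^ 2)%N.
  move=> kN; have E := monom_weightS_sq b d kN.
  have w0 := monom_weight_gt0 b d N m k.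
  have w1 := monom_weight_gt0 b d N m k.+1.
  rewrite -(@ler_pXn2r _ 2 _ (monom_weight b d N m k.+1)) ?nnegrE; [|by []|exact: ltW..].
  have D0 : 0 < (k.+1 * (k + m).+1 * (d + (N - k)) ^ 2)%:R :> R.
    by rewrite ltr0n !muln_gt0 ?expn_gt0; lia.
  rewrite -(ler_pM2r D0) E ler_pM2l; last by rewrite exprn_gt0.
  by rewrite ler_nat.
rewrite !ratio; [|lia..] => h.
have lNm : (m < N - l)%N by lia.
have := @monom_ratio_decr b d m l.+1 (N - l) mb lNm.
by rewrite -subnS -!subnDA !addnS !addSn; apply.
Qed.

End weights.

(** From k^2 <= 2^(k+1) <= 4 (N + 1) one gets (k / (N + 1))^2 <= 4 / (N + 1), which is at most e^2
    once N + 1 >= 4 / e^2. *)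
Lemma log_over_linear (R : realType) (e : R) : 0 < e ->
  exists N0, forall N k, (N0 <= N)%N -> (2 ^ k <= 2 * N.+1)%N ->
    k%:R / N.+1%:R <= e.
Proof.
move=> e0; pose N0 := Num.trunc (4 / e ^+ 2).
exists N0 => N k N0N kN.
have sq : (k ^ 2 <= 2 ^ k.+1)%N.
  elim: k {kN} => [//|[//|[//|[//|k]]]].
  by rewrite (expnS 2 k.+4); lia.
rewrite ler_pdivrMr// -(@ler_pXn2r _ 2) ?nnegrE ?mulr_ge0 ?(ltW e0)//.
apply: (@le_trans _ _ (4 * N.+1%:R)).
  by rewrite -natrX -natrM ler_nat (leq_trans sq)// expnS; lia.
rewrite exprMn [X in _ <= _ * X]expr2 mulrA ler_pM2r//.
rewrite mulrC -ler_pdivrMr ?exprn_gt0//.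
by rewrite (le_trans (ltW (truncnS_gt _)))// ler_nat ltnS.
Qed.

(** * Integration on the sphere *)

Section bounded_measurable.
Context d (T : measurableType d) (R : realType).
Implicit Types (D : set T) (g h : T -> R).

(** On a domain of finite measure this implies integrability, and unlike integrability it is stable
    under products. *)
Definition bounded_measurable D g :=
  measurable_fun D g /\ exists M, forall x, D x -> `|g x| <= M.

Lemma bounded_measurable_cst D c : bounded_measurable D (fun=> c).
Proof. by split; [exact: measurable_cst|exists `|c|]. Qed.

Lemma bounded_measurableD D g h : bounded_measurable D g ->
  bounded_measurable D h -> bounded_measurable D (fun x => g x + h x).
Proof.
move=> [mg [M gM]] [mh [N hN]]; split; first exact: measurable_funD.
by exists (M + N) => x Dx; rewrite (le_trans (ler_normD _ _))// lerD ?gM ?hN.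
Qed.

Lemma bounded_measurableM D g h : bounded_measurable D g ->
  bounded_measurable D h -> bounded_measurable D (fun x => g x * h x).
Proof.
move=> [mg [M gM]] [mh [N hN]]; split; first exact: measurable_funM.
by exists (M * N) => x Dx; rewrite normrM ler_pM ?gM ?hN.
Qed.

Lemma bounded_measurableN D g : bounded_measurable D g ->
  bounded_measurable D (fun x => - g x).
Proof.
move=> bg; under eq_fun do rewrite -mulN1r.
by apply: bounded_measurableM => //; exact: bounded_measurable_cst.
Qed.

Lemma bounded_measurable_eq D g h : (forall x, D x -> g x = h x) ->
  bounded_measurable D g -> bounded_measurable D h.
Proof.
move=> gh [mg [M gM]]; split; last by exists M => x Dx; rewrite -gh// gM.
by apply: eq_measurable_fun mg => x /set_mem; exact: gh.
Qed.

Lemma bounded_measurable_integrable (mu : {measure set T -> \bar R}) D g :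
  measurable D -> (mu D < +oo)%E -> bounded_measurable D g ->
  mu.-integrable D (EFin \o g).
Proof.
move=> mD muD [mg [M gM]]; apply: measurable_bounded_integrable => //.
exists M; split; first exact: num_real.
by move=> N MN x Dx; rewrite /= (le_trans (gM x Dx))// ltW.
Qed.

End bounded_measurable.

(** * Fubini's theorem for products of functions of separate variables *)

Section Rintegral_prod.
Context d1 d2 (T1 : measurableType d1) (T2 : measurableType d2) (R : realType).
Variables (m1 : {sigma_finite_measure set T1 -> \bar R})
  (m2 : {sigma_finite_measure set T2 -> \bar R}).
Variables (D1 : set T1) (D2 : set T2) (g1 : T1 -> R) (g2 : T2 -> R).
Hypotheses (mD1 : measurable D1) (mD2 : measurable D2).
Hypotheses (D1oo : (m1 D1 < +oo)%E) (D2oo : (m2 D2 < +oo)%E).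
Hypotheses (bg1 : bounded_measurable D1 g1) (bg2 : bounded_measurable D2 g2).

Lemma bounded_measurable_prod :
  bounded_measurable (D1 `*` D2) (fun x => g1 x.1 * g2 x.2).
Proof.
move: bg1 bg2 => [mg1 [M1 gM1]] [mg2 [M2 gM2]]; apply: bounded_measurableM.
  split; last by exists M1 => x [D1x _]; exact: gM1.
  apply: (measurable_comp mD1) => //; first by move=> _ [x [? _] <-].
  exact: measurable_funTS.
split; last by exists M2 => x [_ D2x]; exact: gM2.
apply: (measurable_comp mD2) => //; first by move=> _ [x [_ ?] <-].
exact: measurable_funTS.
Qed.

Lemma product_measure_setX_lty : ((m1 \x m2) (D1 `*` D2) < +oo)%E.
Proof. by rewrite product_measure1E// lte_mul_pinfty// ge0_fin_numE. Qed.

Lemma Rintegral_prod :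
  \int[(m1 \x m2)%E]_(x in D1 `*` D2) (g1 x.1 * g2 x.2) =
  (\int[m1]_(x in D1) g1 x) * (\int[m2]_(x in D2) g2 x).
Proof.
have i1 : m1.-integrable D1 (EFin \o g1) by exact: bounded_measurable_integrable.
have i2 : m2.-integrable D2 (EFin \o g2) by exact: bounded_measurable_integrable.
have i12 : (m1 \x m2)%E.-integrable (D1 `*` D2) (EFin \o (fun x => g1 x.1 * g2 x.2)).
  apply: bounded_measurable_integrable bounded_measurable_prod.
    exact: measurableX.
  exact: product_measure_setX_lty.
(* Extension by 0 turns the integrals into integrals over the whole spaces; the extension from a
   rectangle is the product of the two extensions. *)
rewrite [LHS]Rintegral_mkcond (Rintegral_mkcond m1) (Rintegral_mkcond m2).
have i1T : m1.-integrable setT (EFin \o (g1 \_ D1)).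
  by rewrite -restrict_EFin; apply/integrable_restrict => //; rewrite setTI.
have i2T : m2.-integrable setT (EFin \o (g2 \_ D2)).
  by rewrite -restrict_EFin; apply/integrable_restrict => //; rewrite setTI.
have patchE x : ((fun x => g1 x.1 * g2 x.2) \_ (D1 `*` D2)) x =
    (g1 \_ D1) x.1 * (g2 \_ D2) x.2.
  rewrite /patch in_setX.
  by case: (x.1 \in D1); case: (x.2 \in D2) => /=; rewrite ?mul0r ?mulr0.
have i12T : (m1 \x m2)%E.-integrable setT
    (EFin \o ((fun x => g1 x.1 * g2 x.2) \_ (D1 `*` D2))).
  by rewrite -restrict_EFin; apply/integrable_restrict;
    rewrite ?setTI//; exact: measurableX.
rewrite {1}/Rintegral -(integral12_prod_meas1 i12T).
rewrite -RintegralZr//; congr fine; apply: eq_integral => x _.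
transitivity (\int[m2]_y (((g1 \_ D1) x)%:E * (EFin \o (g2 \_ D2)) y))%E.
  by apply: eq_integral => y _; rewrite /= -EFinM -(patchE (x, y)).
rewrite integralZl//= EFinM; congr (_ * _)%E.
by rewrite fineK//; exact: integrable_fin_num.
Qed.

End Rintegral_prod.

Section product_sigma_finite.
Context d1 d2 (T1 : measurableType d1) (T2 : measurableType d2) (R : realType).
Variables (m1 : {sigma_finite_measure set T1 -> \bar R})
  (m2 : {sigma_finite_measure set T2 -> \bar R}).

Lemma product_sigma_finite : sigma_finite setT (m1 \x m2)%E.
Proof.
exact: (measure_function.isSigmaFinite.sigma_finiteT
  (measure_function_Measure_isSigmaFinite__to__measure_function_isSigmaFinite
    m1 m2)).
Qed.

(* The canonical sigma-finite structure on [m1 \x m2] is shadowed in the library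
   by the one for products of subprobabilities. *)
Definition product_sigma_finite_measure :
    {sigma_finite_measure set (T1 * T2)%type -> \bar R} :=
  HB.pack_for {sigma_finite_measure set (T1 * T2)%type -> \bar R} (m1 \x m2)%E
    (Measure_isSigmaFinite.Build _ _ _ (m1 \x m2)%E product_sigma_finite).

End product_sigma_finite.

Section Rintegral_prod3.
Context d1 d2 d3 (T1 : measurableType d1) (T2 : measurableType d2)
  (T3 : measurableType d3) (R : realType).
Variables (m1 : {sigma_finite_measure set T1 -> \bar R})
  (m2 : {sigma_finite_measure set T2 -> \bar R})
  (m3 : {sigma_finite_measure set T3 -> \bar R}).
Variables (D1 : set T1) (D2 : set T2) (D3 : set T3).
Variables (g1 : T1 -> R) (g2 : T2 -> R) (g3 : T3 -> R).
Hypotheses (mD1 : measurable D1) (mD2 : measurable D2) (mD3 : measurable D3).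
Hypotheses (D1oo : (m1 D1 < +oo)%E) (D2oo : (m2 D2 < +oo)%E)
  (D3oo : (m3 D3 < +oo)%E).
Hypotheses (bg1 : bounded_measurable D1 g1) (bg2 : bounded_measurable D2 g2)
  (bg3 : bounded_measurable D3 g3).

Lemma product_measure_setX3_lty :
  (((m1 \x m2) \x m3) (D1 `*` D2 `*` D3) < +oo)%E.
Proof.
apply: (product_measure_setX_lty (m1 := product_sigma_finite_measure m1 m2)).
- exact: measurableX.
- exact: mD3.
- exact: (product_measure_setX_lty mD1 mD2 D1oo D2oo).
- exact: D3oo.
Qed.

Lemma bounded_measurable_prod3 : bounded_measurable (D1 `*` D2 `*` D3)
  (fun x : T1 * T2 * T3 => g1 x.1.1 * g2 x.1.2 * g3 x.2).
Proof.
apply: (bounded_measurable_prod (g1 := fun x => g1 x.1 * g2 x.2)).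
- exact: measurableX.
- exact: mD3.
- exact: bounded_measurable_prod.
- exact: bg3.
Qed.

Lemma Rintegral_prod3 :
  \int[((m1 \x m2) \x m3)%E]_(x in D1 `*` D2 `*` D3)
    (g1 x.1.1 * g2 x.1.2 * g3 x.2) =
  (\int[m1]_(x in D1) g1 x) * (\int[m2]_(x in D2) g2 x) *
  (\int[m3]_(x in D3) g3 x).
Proof.
rewrite -(Rintegral_prod mD1 mD2 D1oo D2oo bg1 bg2).
apply: (Rintegral_prod (m1 := product_sigma_finite_measure m1 m2)
  (g1 := fun x => g1 x.1 * g2 x.2) (g2 := g3)).
- exact: measurableX.
- exact: mD3.
- exact: (product_measure_setX_lty mD1 mD2 D1oo D2oo).
- exact: D3oo.
- exact: bounded_measurable_prod.
- exact: bg3.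
Qed.

End Rintegral_prod3.

(** * Angular integrals *)

Section angular_integral.
Context {R : realType}.
Local Notation mu := (@lebesgue_measure R).

(** The angular factor of z^A conj(z)^B in Hopf coordinates. *)
Definition expi2 (A B : nat) (t : R) : R[i] := expi t ^+ A * (expi t ^+ B)^*%C.

Lemma expi2E A B t :
  expi2 A B t = cos ((A%:R - B%:R) * t) +i* sin ((A%:R - B%:R) * t).
Proof.
rewrite /expi2 !expiX /expi mulrBl cosB sinB /=; simpc.
by congr (_ +i* _); rewrite addrC.
Qed.

Lemma expi2pi : expi (2 * pi : R) = 1.
Proof. by rewrite /expi mulr_natl cos2pi sin2pi. Qed.

Lemma expi2_2pi A B : expi2 A B (2 * pi) = 1.
Proof. by rewrite /expi2 expi2pi !expr1n conjc1 mulr1. Qed.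

Lemma is_derive_scale_comp (f : R -> R) (df c x : R) : is_derive (c * x) 1 f df ->
  is_derive x 1 (fun t => f (c * t)) (c * df).
Proof.
move=> fdf; have cx : is_derive x 1 (fun t : R => c * t) c.
  have := is_deriveZ (f := id) c (is_derive_id x (1 : R)).
  by rewrite /GRing.scale/= mulr1.
have := is_derive1_comp (f := f) (g := fun t => c * t) (x := x).
by move=> /(_ _ _ fdf cx); rewrite /comp mulrC.
Qed.

Lemma integral_derive_2pi (F f : R -> R) :
  (forall x : R, is_derive x 1 F (f x)) -> continuous f -> F 0 = F (2 * pi) ->
  \int[mu]_(t in `[0, 2 * pi[) f t = 0.
Proof.
move=> dF cf F2pi.
have pi0 : 0 < 2 * pi :> R by rewrite mulr_gt0// pi_gt0.
have cF x : {for x, continuous F}.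
  apply: differentiable_continuous; apply/derivable1_diffP.
  by case: (dF x).
rewrite Rintegral_itv_bndo_bndc.
  rewrite /Rintegral (continuous_FTC2 (F := F))//.
  - by rewrite F2pi subee.
  - exact: continuous_subspaceT.
  - split; first by move=> x _; case: (dF x).
    + exact/cvg_at_right_filter/cF.
    + exact/cvg_at_left_filter/cF.
  - by move=> x _; rewrite derive1E; case: (dF x).
have : mu.-integrable `[0, 2 * pi] (EFin \o f).
  apply: continuous_compact_integrable; first exact: segment_compact.
  exact: continuous_subspaceT.
apply: integrableS => //.
exact: subset_itv_co_cc.
Qed.

Lemma expi2_continuous A B :
  continuous (fun t => complex.Re (expi2 A B t)) /\
  continuous (fun t => complex.Im (expi2 A B t)).
Proof.
have sc c : continuous (fun t : R => c * t).
  by move=> t; apply: cvgM; [exact: cvg_cst|exact: cvg_id].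
split.
  under eq_fun do rewrite expi2E /=.
  by move=> t; apply: (continuous_comp (sc _ _)); exact: continuous_cos.
under eq_fun do rewrite expi2E /=.
by move=> t; apply: (continuous_comp (sc _ _)); exact: continuous_sin.
Qed.

Lemma integral_expi2 A B :
  \int[mu]_(t in `[0, 2 * pi[) complex.Re (expi2 A B t) = (A == B)%:R * (2 * pi) /\
  \int[mu]_(t in `[0, 2 * pi[) complex.Im (expi2 A B t) = 0.
Proof.
have [cRe cIm] := expi2_continuous A B.
have pi0 : 0 < 2 * pi :> R by rewrite mulr_gt0// pi_gt0.
have [AB|AB] := eqVneq A B.
  under eq_Rintegral do rewrite expi2E AB subrr mul0r cos0 /=.
  under [X in _ /\ X = _]eq_Rintegral do rewrite expi2E AB subrr mul0r sin0 /=.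
  rewrite !Rintegral_cst//= mul0r mul1r; split=> //.
  by rewrite lebesgue_measure_itv/= lte_fin pi0 oppr0 adde0 mul1r.
have c0 : A%:R - B%:R != 0 :> R by rewrite subr_eq0 eqr_nat.
have ReE : (fun t => complex.Re (expi2 A B t)) = fun t => cos ((A%:R - B%:R) * t).
  by apply/funext => t; rewrite expi2E.
have ImE : (fun t => complex.Im (expi2 A B t)) = fun t => sin ((A%:R - B%:R) * t).
  by apply/funext => t; rewrite expi2E.
(* The primitives agree at 0 and 2 pi because powers of e^(2 pi i) = 1 are 1. *)
move: cRe cIm; have := expi2_2pi A B; rewrite ReE ImE {ReE ImE}.
rewrite expi2E; move: (A%:R - B%:R) c0 => c c0 [cos1 sin1] cRe cIm; split.
  rewrite mul0r.
  apply: (@integral_derive_2pi (fun t => c^-1 * sin (c * t))) => //.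
    move=> x; have := is_deriveZ c^-1 (is_derive_scale_comp (is_derive_sin (c * x))).
    by rewrite /GRing.scale/= mulKf.
  by rewrite mulr0 sin0 sin1.
apply: (@integral_derive_2pi (fun t => - c^-1 * cos (c * t))) => //.
  move=> x; have := is_deriveZ (- c^-1) (is_derive_scale_comp (is_derive_cos (c * x))).
  by rewrite /GRing.scale/= mulrN mulrNN mulKf.
by rewrite mulr0 cos0 cos1.
Qed.

End angular_integral.

(** * Radial integrals *)

Section radial_integral.
Context {R : realType}.
Local Notation mu := (@lebesgue_measure R).

Lemma integral_beta A C :
  \int[mu]_(x in `[0, 1]) (Num.sqrt x ^+ (A + A) * Num.sqrt (1 - x) ^+ (C + C)) =
  (A`! * C`!)%:R / (A + C).+1`!%:R.
Proof.
rewrite -beta_fun_fact /beta_fun -Rintegral_mkcond /=; apply: eq_Rintegral => x.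
rewrite inE/= in_itv/= => /andP[x0 x1].
by rewrite !addnn -!muln2 ![(_ * 2)%N]mulnC !exprM !sqr_sqrtr// subr_ge0.
Qed.

End radial_integral.

(** * The integral over the sphere in Hopf coordinates *)

Section S3_integral.
Context {R : realType}.
Local Notation mu := (@lebesgue_measure R).
Local Notation mu3 := ((mu \x mu) \x mu)%E.
Local Notation D := (@hopf_dom R).
Implicit Types (g h : R[i] * R[i] -> R[i]) (p : R[i] * R[i]).

Lemma measurable_hopf_dom : measurable D.
Proof. by apply: measurableX => //; exact: measurableX. Qed.

Lemma lebesgue_measure_itv_lty (a b : bool) (x y : R) :
  (mu [set` Interval (BSide a x) (BSide b y)] < +oo)%E.
Proof. by rewrite lebesgue_measure_itv/=; case: ifP => _; rewrite ?ltry. Qed.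

Lemma hopf_dom_lty : (mu3 D < +oo)%E.
Proof.
apply: (@product_measure_setX3_lty _ _ _ _ _ _ R mu mu mu).
- exact: measurable_itv.
- exact: measurable_itv.
- exact: measurable_itv.
- exact: lebesgue_measure_itv_lty.
- exact: lebesgue_measure_itv_lty.
- exact: lebesgue_measure_itv_lty.
Qed.

Lemma bounded_measurable_continuous_itv (f : R -> R) a b (x y : R) :
  continuous f ->
  bounded_measurable [set` Interval (BSide a x) (BSide b y)] f.
Proof.
move=> cf; split; first by apply: measurable_funTS; exact: continuous_measurable_fun.
have : compact (f @` `[x, y]).
  by apply: continuous_compact; [exact: continuous_subspaceT|exact: segment_compact].
move=> /compact_bounded[M [_ /(_ (M + 1))]].
rewrite ltrDl ltr01 => /(_ isT) fM; exists (M + 1) => t txy.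
apply: fM; exists t => //; move: txy; rewrite /= !in_itv/=.
by case: a b => [] [] /andP[ta tb]; apply/andP; split=> //; exact: ltW.
Qed.

Lemma hopf_S3 x : D x -> S3 (hopf x).
Proof.
move: x => [[rho t1] t2] [[/= + _] _]; rewrite in_itv/= => /andP[r0 r1].
rewrite /S3/= !normrM !exprMn.
rewrite !norm_expi !expr1n !mulr1 !norm_realc !ger0_norm ?sqrtr_ge0//.
by rewrite -!realcX !sqr_sqrtr ?subr_ge0// -realcD addrC subrK.
Qed.

Definition S3_bounded_measurable g :=
  bounded_measurable D (fun x => complex.Re (g (hopf x))) /\
  bounded_measurable D (fun x => complex.Im (g (hopf x))).
Local Notation bm := S3_bounded_measurable.

Lemma S3_bounded_measurable_eq g h : (forall p, S3 p -> g p = h p) ->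
  bm g -> bm h.
Proof.
move=> gh [gR gI]; split.
  by apply: bounded_measurable_eq gR => x /hopf_S3/gh ->.
by apply: bounded_measurable_eq gI => x /hopf_S3/gh ->.
Qed.

Lemma S3_bounded_measurable_cst c : bm (fun=> c).
Proof. by split; exact: bounded_measurable_cst. Qed.

Lemma S3_bounded_measurableD g h : bm g -> bm h -> bm (fun p => g p + h p).
Proof.
move=> [gR gI] [hR hI]; split.
  under eq_fun do rewrite ReD; exact: bounded_measurableD.
under eq_fun do rewrite ImD; exact: bounded_measurableD.
Qed.

Lemma S3_bounded_measurableM g h : bm g -> bm h -> bm (fun p => g p * h p).
Proof.
move=> [gR gI] [hR hI]; split.
  under eq_fun do rewrite ReM.
  by apply: bounded_measurableD; [|apply: bounded_measurableN];
    exact: bounded_measurableM.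
under eq_fun do rewrite ImM.
by apply: bounded_measurableD; exact: bounded_measurableM.
Qed.

Lemma S3_bounded_measurable_conj g : bm g -> bm (fun p => (g p)^*%C).
Proof.
move=> [gR gI]; split; first by under eq_fun do rewrite Re_conj.
by under eq_fun do rewrite Im_conj; exact: bounded_measurableN.
Qed.

Lemma S3_bounded_measurable_sum (I : Type) (r : seq I) (P : pred I)
    (F : I -> R[i] * R[i] -> R[i]) : (forall i, P i -> bm (F i)) ->
  bm (fun p => \sum_(i <- r | P i) F i p).
Proof.
move=> bF; elim: r => [|i r IHr].
  apply: S3_bounded_measurable_eq (S3_bounded_measurable_cst 0) => p _.
  by rewrite big_nil.
have [Pi|Pi] := boolP (P i).
  apply: S3_bounded_measurable_eq (S3_bounded_measurableD (bF i Pi) IHr) => p _.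
  by rewrite big_cons Pi.
by apply: S3_bounded_measurable_eq IHr => p _; rewrite big_cons (negbTE Pi).
Qed.

Lemma S3_bounded_measurableX g n : bm g -> bm (fun p => g p ^+ n).
Proof.
move=> bg; elim: n => [|n IHn].
  by apply: S3_bounded_measurable_eq (S3_bounded_measurable_cst 1) => p _.
apply: S3_bounded_measurable_eq (S3_bounded_measurableM bg IHn) => p _.
by rewrite exprS.
Qed.

Lemma S3_bounded_measurable_normsq g : bm g -> bm (fun p => `|g p| ^+ 2).
Proof.
move=> bg; have bgg := S3_bounded_measurableM bg (S3_bounded_measurable_conj bg).
by apply: S3_bounded_measurable_eq bgg => p _; rewrite sqr_normc.
Qed.

Lemma hopf_dom_prod_bounded_measurable (u v w : R -> R) :
  continuous u -> continuous v -> continuous w ->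
  bounded_measurable D (fun x => u x.1.1 * v x.1.2 * w x.2).
Proof.
move=> cu cv cw; apply: bounded_measurable_prod3;
  try exact: measurable_itv; exact: bounded_measurable_continuous_itv.
Qed.

Lemma S3_bounded_measurable_coord : bm (fun p => p.1) /\ bm (fun p => p.2).
Proof.
have sqrtn := sqrt_continuous (R := R).
have sqrt1 : continuous (fun x : R => Num.sqrt (1 - x)).
  have c1 : continuous (fun x : R => 1 - x).
    by move=> x; apply: cvgB; [exact: cvg_cst|exact: cvg_id].
  by move=> x; apply: (continuous_comp (c1 x)); exact: sqrt_continuous.
have cst1 : continuous (fun _ : R => 1 : R) by move=> x; exact: cvg_cst.
split; split.
- have := hopf_dom_prod_bounded_measurable sqrtn (@continuous_cos R) cst1.
  by apply: bounded_measurable_eq => -[[rho t1] t2] _ /=; rewrite mul0r subr0 mulr1.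
- have := hopf_dom_prod_bounded_measurable sqrtn (@continuous_sin R) cst1.
  by apply: bounded_measurable_eq => -[[rho t1] t2] _ /=; rewrite mul0r addr0 mulr1.
- have := hopf_dom_prod_bounded_measurable sqrt1 cst1 (@continuous_cos R).
  by apply: bounded_measurable_eq => -[[rho t1] t2] _ /=; rewrite mul0r subr0 mulr1.
- have := hopf_dom_prod_bounded_measurable sqrt1 cst1 (@continuous_sin R).
  by apply: bounded_measurable_eq => -[[rho t1] t2] _ /=; rewrite mul0r addr0 mulr1.
Qed.

Lemma S3_Rint_eq (g h : R[i] * R[i] -> R) : (forall p, S3 p -> g p = h p) ->
  S3_Rint g = S3_Rint h.
Proof.
move=> gh; rewrite /S3_Rint; congr (_ * _); apply: eq_Rintegral => x.
by rewrite inE => /hopf_S3/gh.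
Qed.

Lemma S3_int_eq g h : (forall p, S3 p -> g p = h p) -> S3_int g = S3_int h.
Proof.
by move=> gh; rewrite /S3_int; congr (_ +i* _); apply: S3_Rint_eq => p /gh ->.
Qed.

Let itg (f : R[i] * R[i] -> R) := bounded_measurable D (fun x => f (hopf x)).

Let itgP f : itg f -> mu3.-integrable D (EFin \o (fun x => f (hopf x))).
Proof.
exact: (@bounded_measurable_integrable _ _ R mu3 D (fun x => f (hopf x))
  measurable_hopf_dom hopf_dom_lty).
Qed.

Let S3_RintD f1 f2 : itg f1 -> itg f2 ->
  S3_Rint (fun p => f1 p + f2 p) = S3_Rint f1 + S3_Rint f2.
Proof.
move=> b1 b2; rewrite /S3_Rint RintegralD ?mulrDr//; try exact: itgP.
exact: measurable_hopf_dom.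
Qed.

Let S3_RintZ c f : itg f -> S3_Rint (fun p => c * f p) = c * S3_Rint f.
Proof.
move=> b; rewrite /S3_Rint RintegralZl 1?mulrCA//; try exact: itgP.
exact: measurable_hopf_dom.
Qed.

Let S3_Rint_le f1 f2 : itg f1 -> itg f2 -> (forall p, S3 p -> f1 p <= f2 p) ->
  S3_Rint f1 <= S3_Rint f2.
Proof.
move=> b1 b2 le12; rewrite /S3_Rint ler_wpM2l ?invr_ge0 ?mulr_ge0 ?pi_ge0//.
apply: (@le_Rintegral _ _ R mu3 D (fun x => f1 (hopf x)) (fun x => f2 (hopf x))
  measurable_hopf_dom (itgP b1) (itgP b2)).
by move=> x /hopf_S3/le12.
Qed.

Lemma S3_intD g h : bm g -> bm h ->
  S3_int (fun p => g p + h p) = S3_int g + S3_int h.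
Proof.
move=> [gR gI] [hR hI]; rewrite /S3_int; simpc; congr (_ +i* _).
  by rewrite -S3_RintD//; apply: S3_Rint_eq => p _; rewrite ReD.
by rewrite -S3_RintD//; apply: S3_Rint_eq => p _; rewrite ImD.
Qed.

Lemma S3_intZ c g : bm g -> S3_int (fun p => c * g p) = c * S3_int g.
Proof.
case: c => a b [gR gI]; rewrite /S3_int; simpc; congr (_ +i* _).
  rewrite -!S3_RintZ// -mulN1r -S3_RintZ; last first.
    exact/bounded_measurableM/gI/bounded_measurable_cst.
  rewrite -S3_RintD; [|exact/bounded_measurableM/gR/bounded_measurable_cst|].
    by apply: S3_Rint_eq => p _; rewrite ReM/= mulN1r.
  apply: bounded_measurableM; first exact: bounded_measurable_cst.
  exact/bounded_measurableM/gI/bounded_measurable_cst.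
rewrite -!S3_RintZ// -S3_RintD.
- by apply: S3_Rint_eq => p _; rewrite ImM.
- exact/bounded_measurableM/gI/bounded_measurable_cst.
- exact/bounded_measurableM/gR/bounded_measurable_cst.
Qed.

Lemma S3_int_sum (I : Type) (r : seq I) (P : pred I)
    (F : I -> R[i] * R[i] -> R[i]) : (forall i, P i -> bm (F i)) ->
  S3_int (fun p => \sum_(i <- r | P i) F i p) = \sum_(i <- r | P i) S3_int (F i).
Proof.
move=> bF; elim: r => [|i r IHr].
  rewrite big_nil (S3_int_eq (h := fun p => 0 * 0)); last first.
    by move=> p _; rewrite big_nil mulr0.
  by rewrite (S3_intZ 0 (S3_bounded_measurable_cst 0)) mul0r.
rewrite big_cons -IHr; case: ifP => Pi.
  rewrite -S3_intD; [|exact: bF|exact: S3_bounded_measurable_sum].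
  by apply: S3_int_eq => p _; rewrite big_cons Pi.
by apply: S3_int_eq => p _; rewrite big_cons Pi.
Qed.

Lemma S3_int_conj g : bm g -> S3_int (fun p => (g p)^*%C) = (S3_int g)^*%C.
Proof.
move=> [gR gI]; rewrite /S3_int /=; congr (_ +i* _).
  by apply: S3_Rint_eq => p _; rewrite Re_conj.
rewrite -mulN1r -S3_RintZ//; apply: S3_Rint_eq => p _.
by rewrite Im_conj mulN1r.
Qed.

(** The real and imaginary parts are bounded separately, each by the integral of h, which accounts
    for the factor 2. The order of [R[i]] makes h real on the sphere. *)
Lemma S3_int_norm_le g h : bm g -> bm h -> (forall p, S3 p -> `|g p| <= h p) ->
  `|S3_int g| <= 2 * S3_int h.
Proof.
move=> [gR gI] [hR hI] gh.
have nE (z : R[i]) : `|z| = (ComplexField.Normc.normc z)%:C by case: z.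
have gh' p : S3 p ->
    ComplexField.Normc.normc (g p) <= complex.Re (h p) /\ complex.Im (h p) = 0.
  by move=> /gh; rewrite nE lecE/= => /andP[/eqP -> ->].
have Imh : complex.Im (S3_int h) = 0.
  rewrite /= (S3_Rint_eq (h := fun p => 0 * 0)).
    by rewrite (S3_RintZ 0 (bounded_measurable_cst _ 0)) mul0r.
  by move=> p /gh'[_ ->]; rewrite mulr0.
have ReIm (z : R[i]) : `|complex.Re z| <= ComplexField.Normc.normc z /\
    `|complex.Im z| <= ComplexField.Normc.normc z.
  case: z => a b /=; rewrite -!sqrtr_sqr; split; apply: ler_wsqrtr;
    by rewrite ?lerDl ?lerDr sqr_ge0.
have bnd (f : R[i] * R[i] -> R) : itg f ->
    (forall p, S3 p -> `|f p| <= complex.Re (h p)) ->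
    `|S3_Rint f| <= complex.Re (S3_int h).
  move=> bf fh; rewrite ler_norml; apply/andP; split.
    rewrite lerNl -mulN1r -S3_RintZ//; apply: S3_Rint_le => //.
      exact/bounded_measurableM/bf/bounded_measurable_cst.
    by move=> p /fh; rewrite mulN1r ler_norml lerNl => /andP[].
  by apply: S3_Rint_le => // p /fh; rewrite ler_norml => /andP[].
have h1 : `|S3_Rint (fun p => complex.Re (g p))| <= complex.Re (S3_int h).
  by apply: bnd => // p /gh'[+ _]; apply: le_trans; have [] := ReIm (g p).
have h2 : `|S3_Rint (fun p => complex.Im (g p))| <= complex.Re (S3_int h).
  by apply: bnd => // p /gh'[+ _]; apply: le_trans; have [] := ReIm (g p).
have hE : S3_int h = (complex.Re (S3_int h))%:C.
  by apply/eqP; rewrite eq_complex /= eqxx/= -[X in X == _]/(complex.Im (S3_int h)) Imh.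
rewrite hE nE -[2](rmorph_nat (real_complex R)) -rmorphM lecR mulr_natl mulr2n.
apply: le_trans (lerD h1 h2).
rewrite /S3_int /= -(@ler_pXn2r _ 2) ?nnegrE ?sqrtr_ge0 ?addr_ge0//.
rewrite sqr_sqrtr ?addr_ge0 ?sqr_ge0// sqrrD !real_normK ?num_real// addrAC.
by rewrite lerDl mulrn_wge0// mulr_ge0.
Qed.

End S3_integral.

(** * Moments of monomials, and uniform limits *)

Section S3_moments.
Context {R : realType}.
Local Notation mu := (@lebesgue_measure R).
Local Notation mu3 := ((mu \x mu) \x mu)%E.
Local Notation D := (@hopf_dom R).
Implicit Types (f g : R[i] * R[i] -> R[i]) (p : R[i] * R[i]).

Lemma hopf_dom_Rintegral_prod (u v w : R -> R) :
  continuous u -> continuous v -> continuous w ->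
  \int[mu3]_(x in D) (u x.1.1 * v x.1.2 * w x.2) =
  (\int[mu]_(x in `[0, 1]) u x) * (\int[mu]_(x in `[0, 2 * pi[) v x) *
  (\int[mu]_(x in `[0, 2 * pi[) w x).
Proof.
move=> cu cv cw.
apply: (@Rintegral_prod3 _ _ _ _ _ _ R mu mu mu);
  try exact: measurable_itv; try exact: lebesgue_measure_itv_lty;
  exact: bounded_measurable_continuous_itv.
Qed.

Definition bimonom (A B C E : nat) p : R[i] :=
  p.1 ^+ A * (p.1 ^+ B)^*%C * (p.2 ^+ C * (p.2 ^+ E)^*%C).

Lemma bimonom_bounded_measurable A B C E :
  S3_bounded_measurable (bimonom A B C E).
Proof.
have [b1 b2] := @S3_bounded_measurable_coord R.
by apply: S3_bounded_measurableM; apply: S3_bounded_measurableM;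
  try apply: S3_bounded_measurable_conj; exact: S3_bounded_measurableX.
Qed.

Lemma bimonom_hopf A B C E (x : R * R * R) :
  bimonom A B C E (hopf x) =
  (Num.sqrt x.1.1 ^+ (A + B) * Num.sqrt (1 - x.1.1) ^+ (C + E))%:C *
  (expi2 A B x.1.2 * expi2 C E x.2).
Proof.
case: x => [[rho t1] t2].
rewrite /bimonom /expi2 !exprMn !conjcM -!realcX !conjc_real !exprD !realcM.
by ring.
Qed.

Lemma S3_int_bimonom A B C E : S3_int (bimonom A B C E) =
  if (A == B) && (C == E) then ((A`! * C`!)%:R / (A + C).+1`!%:R)%:C else 0.
Proof.
pose rad (x : R) := Num.sqrt x ^+ (A + B) * Num.sqrt (1 - x) ^+ (C + E).
have c_rad : continuous rad.
  have c1 : continuous (fun x : R => 1 - x).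
    by move=> x; apply: cvgB; [exact: cvg_cst|exact: cvg_id].
  have cs : continuous (fun x : R => Num.sqrt (1 - x)).
    by move=> x; apply: (continuous_comp (c1 x)); exact: sqrt_continuous.
  have cX (u : R -> R) n : continuous u -> continuous (fun x => u x ^+ n).
    move=> cu x; apply: (continuous_comp (g := fun y : R => y ^+ n) (cu x)).
    exact: exprn_continuous.
  have cr := cX _ (A + B)%N (@sqrt_continuous R); have ct := cX _ (C + E)%N cs.
  by move=> x; apply: cvgM; [exact: cr|exact: ct].
have [cR1 cI1] := @expi2_continuous R A B.
have [cR2 cI2] := @expi2_continuous R C E.
have [iR1 iI1] := @integral_expi2 R A B.
have [iR2 iI2] := @integral_expi2 R C E.
have itg (u v w : R -> R) : continuous u -> continuous v -> continuous w ->
    mu3.-integrable D (EFin \o (fun x => u x.1.1 * v x.1.2 * w x.2)).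
  move=> cu cv cw.
  exact: (@bounded_measurable_integrable _ _ R mu3 D _ measurable_hopf_dom
    hopf_dom_lty (hopf_dom_prod_bounded_measurable cu cv cw)).
(* The real and imaginary parts of a product of two angular factors are combinations of separated
   integrands, and each of those containing an imaginary part integrates to 0. *)
have -> : S3_int (bimonom A B C E) =
    ((4 * pi ^+ 2)^-1 * ((\int[mu]_(x in `[0, 1]) rad x) *
      ((A == B)%:R * (2 * pi)) * ((C == E)%:R * (2 * pi))))%:C.
  rewrite /S3_int /S3_Rint; congr (_ +i* _).
    congr (_ * _).
    transitivity (\int[mu3]_(x in D) (rad x.1.1 * complex.Re (expi2 A B x.1.2) *
      complex.Re (expi2 C E x.2)) - \int[mu3]_(x in D) (rad x.1.1 *
      complex.Im (expi2 A B x.1.2) * complex.Im (expi2 C E x.2))).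
      rewrite -(@RintegralB _ _ R mu3 D _ _ measurable_hopf_dom (itg _ _ _ c_rad cR1 cR2)
        (itg _ _ _ c_rad cI1 cI2)).
      apply: eq_Rintegral => x _; rewrite bimonom_hopf !ReM /= /rad.
      by rewrite mul0r subr0 mulrBr !mulrA.
    rewrite (hopf_dom_Rintegral_prod c_rad cR1 cR2).
    rewrite (hopf_dom_Rintegral_prod c_rad cI1 cI2).
    by rewrite iR1 iR2 iI1 mulr0 mul0r subr0.
  rewrite -[RHS](mulr0 (4 * pi ^+ 2)^-1); congr (_ * _).
  transitivity (\int[mu3]_(x in D) (rad x.1.1 * complex.Re (expi2 A B x.1.2) *
      complex.Im (expi2 C E x.2)) + \int[mu3]_(x in D) (rad x.1.1 *
      complex.Im (expi2 A B x.1.2) * complex.Re (expi2 C E x.2))).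
    rewrite -(@RintegralD _ _ R mu3 D _ _ measurable_hopf_dom (itg _ _ _ c_rad cR1 cI2)
      (itg _ _ _ c_rad cI1 cR2)).
    apply: eq_Rintegral => x _; rewrite bimonom_hopf !ImM /= /rad.
    by rewrite mul0r addr0 mulrDr !mulrA.
  rewrite (hopf_dom_Rintegral_prod c_rad cR1 cI2).
  rewrite (hopf_dom_Rintegral_prod c_rad cI1 cR2).
  by rewrite iI1 iI2 !(mulr0, mul0r) addr0.
have [AB|_] := eqVneq A B; last by rewrite !(mulr0, mul0r).
have [CE|_] := eqVneq C E; last by rewrite !(mulr0, mul0r).
rewrite /rad -AB -CE integral_beta /= !mul1r; congr (_%:C).
have pi0 : pi != 0 :> R by rewrite gt_eqF// pi_gt0.
by move: (_ / _) (pi) pi0 => x y y0; field.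
Qed.

(** Smoothness on the sphere is a local condition on extensions, so measurability of f in Hopf
    coordinates is derived from uniform approximation by polynomials. *)
Lemma S3_bounded_measurable_lim f :
  (forall e : R, 0 < e -> exists2 g, S3_bounded_measurable g &
     forall p, S3 p -> `|f p - g p| <= e%:C) ->
  S3_bounded_measurable f.
Proof.
move=> fg.
have [g gP] : exists g : nat -> R[i] * R[i] -> R[i], forall n,
    S3_bounded_measurable (g n) /\
    forall p, S3 p -> `|f p - g n p| <= (n.+1%:R^-1 : R)%:C.
  have /choice[g gP] n : exists g, S3_bounded_measurable g /\
      forall p, S3 p -> `|f p - g p| <= (n.+1%:R^-1 : R)%:C.
    by have [|g bg gf] := fg n.+1%:R^-1; [rewrite invr_gt0 ltr0n|exists g].
  by exists g.
have key (r : R[i] -> R) : (forall z, `|r z|%:C <= `|z|) ->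
    (forall z w, r (z - w) = r z - r w) ->
    (forall n, bounded_measurable D (fun x => r (g n (hopf x)))) ->
    bounded_measurable D (fun x => r (f (hopf x))).
  move=> rle rB bg.
  have close n x : D x -> `|r (f (hopf x)) - r (g n (hopf x))| <= n.+1%:R^-1.
    move=> /hopf_S3 Sx; rewrite -lecR -rB; apply: le_trans (rle _) _.
    exact: (gP n).2.
  split.
    apply: (@measurable_fun_cvg _ _ R D (fun n x => r (g n (hopf x)))).
      by move=> n; exact: (bg n).1.
    move=> x Dx; apply/cvgrPdist_le => e e0.
    have := near_infty_natSinv_lt (PosNum e0); apply: filterS => n /= ne.
    by rewrite (le_trans (close n x Dx))// ltW.
  have [_ [M gM]] := bg 0%N; exists (1 + M) => x Dx.
  rewrite -[r (f _)](subrK (r (g 0%N (hopf x)))) (le_trans (ler_normD _ _))//.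
  by rewrite lerD ?gM// (le_trans (close 0%N x Dx))// invr1.
have ReB (z w : R[i]) : complex.Re (z - w) = complex.Re z - complex.Re w.
  by case: z w => ? ? [].
have ImB (z w : R[i]) : complex.Im (z - w) = complex.Im z - complex.Im w.
  by case: z w => ? ? [].
split.
- apply: key => //; first exact: normc_ge_Re.
  by move=> n; exact: (gP n).1.1.
- apply: key => //; last by move=> n; exact: (gP n).1.2.
  move=> z; have := normc_ge_Re ('i%C * z).
  rewrite normrM mulrC ReiNIm normrN (_ : `|'i%C| = 1) ?mul1r//.
  by rewrite normc_def/= expr0n expr1n add0r sqrtr1.
Qed.

End S3_moments.

(** * Density of polynomials *)

Section bernstein.
Context {R : realType}.
Implicit Types (a C K c : R) (phi psi : nat -> R) (n : nat).

(* The Bernstein polynomial \sum_(i <= n) 'C(n, i) a^i (1 - a)^(n - i) phi(i),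
   that is, the expectation of [phi] at the number of successes in [n] trials. *)
Fixpoint bern a n phi : R :=
  if n is n'.+1 then
    (1 - a) * bern a n' phi + a * bern a n' (fun i => phi i.+1)
  else phi 0%N.

Lemma bern_le a n phi psi : 0 <= a <= 1 -> (forall i, phi i <= psi i) ->
  bern a n phi <= bern a n psi.
Proof.
move=> /andP[a0 a1]; elim: n phi psi => [|n IHn] phi psi le /=; first exact: le.
by apply: lerD; rewrite ler_wpM2l ?subr_ge0// IHn.
Qed.

(** The Bernstein weights are nonnegative with sum 1, so this is the triangle inequality for an
    average. *)
Lemma bern_dist a n phi c : 0 <= a <= 1 ->
  `|c - bern a n phi| <= bern a n (fun i => `|c - phi i|).
Proof.
move=> /andP[a0 a1]; elim: n phi => [|n IHn] phi //=.
have a1' : 0 <= 1 - a by rewrite subr_ge0.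
have -> : c - ((1 - a) * bern a n phi + a * bern a n (fun i => phi i.+1)) =
  (1 - a) * (c - bern a n phi) + a * (c - bern a n (fun i => phi i.+1)) by ring.
apply: (le_trans (ler_normD _ _)); rewrite !normrM (ger0_norm a0) (ger0_norm a1').
by apply: lerD; rewrite ler_wpM2l.
Qed.

(** Squared bias plus the binomial variance n a (1 - a). The centre c is arbitrary because one more
    success amounts to replacing c by c - 1 in the induction. *)
Lemma bern_moment a n C K c :
  bern a n (fun i => C + K * (i%:R - c) ^+ 2) =
  C + K * ((n%:R * a - c) ^+ 2 + n%:R * (a * (1 - a))).
Proof.
elim: n c => [|n IHn] c /=; first by rewrite !mul0r addr0.
have -> : (fun i => C + K * (i.+1%:R - c) ^+ 2) =
    (fun i => C + K * (i%:R - (c - 1)) ^+ 2).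
  by apply/funext => i; rewrite -natr1; congr (_ + _ * _ ^+ 2); ring.
by rewrite !IHn -natr1; ring.
Qed.

(** The success frequency in [n.+1] trials, carried from [0, 1] to [-1, 1]. *)
Definition bern_node n i : R := 2 * i%:R / n.+1%:R - 1.

(** The nodes have mean 2a - 1 and variance 4 a (1 - a) / (n + 1), and 4 a (1 - a) <= 1. *)
Lemma bern_sqdist_le a n C K : 0 <= K -> 0 <= a <= 1 ->
  bern a n.+1 (fun i => C + K * (2 * a - 1 - bern_node n i) ^+ 2) <=
  C + K / n.+1%:R.
Proof.
move=> K0 /andP[a0 a1]; set N : R := n.+1%:R; have N0 : 0 < N by rewrite ltr0n.
have -> : (fun i => C + K * (2 * a - 1 - bern_node n i) ^+ 2) =
    (fun i => C + (4 * K / N ^+ 2) * (i%:R - N * a) ^+ 2).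
  by apply/funext => i; rewrite /bern_node -/N; field; rewrite gt_eqF.
rewrite bern_moment -/N subrr expr0n add0r lerD2l.
have -> : 4 * K / N ^+ 2 * (N * (a * (1 - a))) = K / N * (4 * (a * (1 - a))).
  by field; rewrite gt_eqF.
rewrite ler_piMr ?divr_ge0 ?(ltW N0)// -subr_ge0.
have -> : 1 - 4 * (a * (1 - a)) = (2 * a - 1) ^+ 2 by ring.
exact: sqr_ge0.
Qed.

End bernstein.

(** * Polynomials in z, w and their conjugates *)

Section bipoly.
Context {R : realType}.
Implicit Types (f g : R[i] * R[i] -> R[i]) (p : R[i] * R[i]).

(** A linear span rather than a generated algebra, so that statements linear in f follow by
    induction from the monomials. *)
Inductive bipoly : (R[i] * R[i] -> R[i]) -> Prop :=
| bipoly_monom A B C E : bipoly (bimonom A B C E)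
| bipolyD f g : bipoly f -> bipoly g -> bipoly (fun p => f p + g p)
| bipolyZ c f : bipoly f -> bipoly (fun p => c * f p).

Lemma bipolyM f g : bipoly f -> bipoly g -> bipoly (fun p => f p * g p).
Proof.
move=> bf bg; elim: bf => [A B C E|f1 f2 _ h1 _ h2|c f1 _ h1].
- elim: bg => [A' B' C' E'|g1 g2 _ h1 _ h2|c g1 _ h1].
  + have := bipoly_monom (A + A') (B + B') (C + C') (E + E').
    congr bipoly; apply/funext => p; rewrite /bimonom !exprD.
    by rewrite !conjcM; ring.
  + have := bipolyD h1 h2; congr bipoly; apply/funext => p; by rewrite mulrDr.
  + have := bipolyZ c h1; congr bipoly; apply/funext => p; by rewrite mulrCA.
- have := bipolyD h1 h2; congr bipoly; apply/funext => p; by rewrite mulrDl.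
- have := bipolyZ c h1; congr bipoly; apply/funext => p; by rewrite mulrA.
Qed.

Lemma bipoly_cst c : bipoly (fun=> c).
Proof.
have := bipolyZ c (bipoly_monom 0 0 0 0); congr bipoly; apply/funext => p.
by rewrite /bimonom !expr0 conjc1 !mulr1.
Qed.

Lemma bipoly_coord1 : bipoly (fun p => (complex.Re p.1)%:C) /\
  bipoly (fun p => (complex.Im p.1)%:C).
Proof.
split.
  have := bipolyZ 2^-1 (bipolyD (bipoly_monom 1 0 0 0) (bipoly_monom 0 1 0 0)).
  congr bipoly; apply/funext => p.
  by rewrite /bimonom !expr0 conjc1 !expr1 !mulr1 mul1r ReJ_add mulrC.
have := bipolyZ ('i%C / 2)
  (bipolyD (bipoly_monom 0 1 0 0) (bipolyZ (-1) (bipoly_monom 1 0 0 0))).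
congr bipoly; apply/funext => p.
by rewrite /bimonom !expr0 conjc1 !expr1 !mulr1 mul1r ImJ_sub mulN1r; ring.
Qed.

Lemma bipoly_coord2 : bipoly (fun p => (complex.Re p.2)%:C) /\
  bipoly (fun p => (complex.Im p.2)%:C).
Proof.
split.
  have := bipolyZ 2^-1 (bipolyD (bipoly_monom 0 0 1 0) (bipoly_monom 0 0 0 1)).
  congr bipoly; apply/funext => p.
  by rewrite /bimonom !expr0 conjc1 !expr1 !mulr1 !mul1r ReJ_add mulrC.
have := bipolyZ ('i%C / 2)
  (bipolyD (bipoly_monom 0 0 0 1) (bipolyZ (-1) (bipoly_monom 0 0 1 0))).
congr bipoly; apply/funext => p.
by rewrite /bimonom !expr0 conjc1 !expr1 !mulr1 !mul1r ImJ_sub mulN1r; ring.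
Qed.

(** The values [phi i] may themselves depend on p, so the operator can be nested over the
    coordinates. *)
Lemma bipoly_bern (a : R[i] * R[i] -> R) n (phi : nat -> R[i] * R[i] -> R) :
  bipoly (fun p => (a p)%:C) -> (forall i, bipoly (fun p => (phi i p)%:C)) ->
  bipoly (fun p => (bern (a p) n (fun i => phi i p))%:C).
Proof.
move=> ba; elim: n phi => [|n IHn] phi bphi /=; first exact: bphi.
have b1a := bipolyD (bipoly_cst 1) (bipolyZ (-1) ba).
have := bipolyD (bipolyM b1a (IHn phi bphi))
  (bipolyM ba (IHn (fun i => phi i.+1) (fun i => bphi i.+1))).
congr bipoly; apply/funext => p.
by rewrite realcD !realcM realcB mulN1r.
Qed.

Lemma bipoly_bounded_measurable f : bipoly f -> S3_bounded_measurable f.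
Proof.
elim=> [A B C E|f1 f2 _ b1 _ b2|c f1 _ b1].
- exact: bimonom_bounded_measurable.
- exact: S3_bounded_measurableD.
- exact: S3_bounded_measurableM (S3_bounded_measurable_cst c) b1.
Qed.

End bipoly.

(** * Geometry of the sphere and uniform approximation *)

Section sphere.
Context {R : realType}.
Implicit Types (x y q : 'rV[R]_4) (h : 'rV[R]_4 -> R) (p : R[i] * R[i]).

(** The squared Euclidean norm; the norm carried by row vectors is the maximum norm. *)
Definition sqn x : R := \sum_(i < 4) x 0 i ^+ 2.

Lemma sqnE x : sqn x = x 0 (inord 0) ^+ 2 + x 0 (inord 1) ^+ 2 +
  x 0 (inord 2) ^+ 2 + x 0 (inord 3) ^+ 2.
Proof.
rewrite /sqn !big_ord_recr big_ord0 /= add0r.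
by do !congr (_ + _); congr (x 0 _ ^+ 2); apply/val_inj; rewrite /= inordK.
Qed.

Lemma sqn_ge0 x : 0 <= sqn x.
Proof. by rewrite sumr_ge0// => i _; exact: sqr_ge0. Qed.

Lemma coord_sq_le_sqn x i : x 0 i ^+ 2 <= sqn x.
Proof.
by rewrite /sqn (bigD1 i)//= lerDl sumr_ge0// => j _; exact: sqr_ge0.
Qed.

Lemma sqnB_le x y q : sqn (x - y) <= 2 * sqn (x - q) + 2 * sqn (q - y).
Proof.
rewrite /sqn !mulr_sumr -big_split/=; apply: ler_sum => i _; rewrite !mxE -subr_ge0.
have -> : 2 * (x 0 i - q 0 i) ^+ 2 + 2 * (q 0 i - y 0 i) ^+ 2 - (x 0 i - y 0 i) ^+ 2 =
  (x 0 i - q 0 i - (q 0 i - y 0 i)) ^+ 2 by ring.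
exact: sqr_ge0.
Qed.

Lemma sqnC x y : sqn (x - y) = sqn (y - x).
Proof. by apply: eq_bigr => i _; rewrite !mxE -sqrrN opprB. Qed.

Lemma sqn_continuous y : continuous (fun x => sqn (x - y)).
Proof.
have c (i : 'I_4) : continuous (fun x => (x - y) 0 i ^+ 2).
  have -> : (fun x => (x - y) 0 i ^+ 2) = fun x => (x 0 i - y 0 i) ^+ 2.
    by apply/funext => x; rewrite !mxE.
  have cc : continuous (fun x : 'rV[R]_4 => x 0 i) by exact: coord_continuous.
  have c1 : continuous (fun x : 'rV[R]_4 => x 0 i - y 0 i).
    by move=> x; apply: continuousB; [exact: cc|exact: cst_continuous].
  move=> x; apply: (continuous_comp (g := fun t : R => t ^+ 2) (c1 x)).
  exact: exprn_continuous.
have -> : (fun x => sqn (x - y)) = fun x => (x - y) 0 (inord 0) ^+ 2 +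
    (x - y) 0 (inord 1) ^+ 2 + (x - y) 0 (inord 2) ^+ 2 + (x - y) 0 (inord 3) ^+ 2.
  by apply/funext => x; rewrite sqnE.
have cD (f g : 'rV[R]_4 -> R) : continuous f -> continuous g ->
    continuous (fun x => f x + g x).
  by move=> cf cg x; exact: (continuousD (cf x) (cg x)).
exact: (cD _ _ (cD _ _ (cD _ _ (c _) (c _)) (c _)) (c _)).
Qed.

Lemma near_sqn x (e : R) : 0 < e -> \forall y \near x, sqn (y - x) < e.
Proof.
move=> e0; have := @sqn_continuous x x.
rewrite /continuous_at subrr (_ : sqn 0 = 0); last first.
  by rewrite /sqn big1// => i _; rewrite mxE expr0n.
move=> /cvgrPdist_lt/(_ _ e0); apply: filterS => y.
by rewrite sub0r normrN ger0_norm// sqn_ge0.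
Qed.

Lemma nbhs_sqn x (U : set 'rV[R]_4) : nbhs x U ->
  exists2 e : R, 0 < e & forall y, sqn (y - x) < e -> U y.
Proof.
move=> /nbhs_ballP[r /= r0 rU]; exists (r ^+ 2); first exact: exprn_gt0.
move=> y yr; apply: rU; split=> // i j; rewrite (ord1 i) /ball/=.
rewrite -(@ltr_pXn2r _ 2) ?nnegrE ?(ltW r0)// real_normK ?num_real//.
apply: le_lt_trans yr; rewrite sqnC; apply: le_trans (coord_sq_le_sqn _ j).
by rewrite !mxE.
Qed.

Lemma sphere_compact : compact [set x | sqn x = 1].
Proof.
apply: bounded_closed_compact.
  exists 1; split; first exact: num_real.
  move=> M M1 x /= sx; apply: (@le_trans _ _ 1); last exact: ltW.
  rewrite [leLHS]/Num.norm/= mx_normrE; apply/bigmax_leP; split=> // -[i j] _ /=.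
  rewrite -(@ler_pXn2r _ 2) ?nnegrE// expr1n real_normK ?num_real// -sx (ord1 i).
  exact: coord_sq_le_sqn.
have -> : [set x | sqn x = 1] = (fun x => sqn (x - 0)) @^-1` [set 1].
  by apply/seteqP; split => x /=; rewrite subr0.
apply: closed_comp => [x _|]; first exact: sqn_continuous.
exact: closed_eq.
Qed.

(** Close points are covered by e through uniform continuity, distant ones by the quadratic term,
    since h is bounded on the compact sphere. *)
Lemma sphere_modulus h :
  (forall x, sqn x = 1 -> forall e : R, 0 < e ->
     \forall y \near x, sqn y = 1 -> `|h x - h y| <= e) ->
  forall e : R, 0 < e -> exists2 K, 0 <= K & forall x y, sqn x = 1 -> sqn y = 1 ->
    `|h x - h y| <= e + K * sqn (x - y).
Proof.
move=> ch e e0.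
(* Compactness as a covering principle: what holds locally for all large m holds on the whole sphere
   for some m. *)
have /compact_near_coveringP/near_covering_withinP cov := sphere_compact.
have [B hB] : exists B : nat, forall x, sqn x = 1 -> `|h x| <= B%:R.
  have [] := cov nat \oo (fun m x => `|h x| <= m%:R) _.
    move=> x sx.
    exists ([set y | sqn y = 1 -> `|h x - h y| <= 1], [set m | `|h x| + 1 <= m%:R]).
      split => /=; first exact: ch.
      exact: nbhs_infty_ger.
    move=> [y m] [/= hxy mle] sy.
    rewrite -(subKr (h x) (h y)) (le_trans (ler_normB _ _))//.
    by rewrite (le_trans _ mle)// lerD2l hxy.
  by move=> N _ hN; exists N => x sx; exact: (hN N (leqnn N)).
have [] := cov nat \oo (fun m x => forall y, sqn y = 1 ->
    `|h x - h y| <= e + m%:R * sqn (x - y)) _; last first.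
  by move=> N _ hN; exists N%:R => // x y sx; exact: (hN N (leqnn N)).
move=> x sx.
have e2 : 0 < e / 2 by rewrite divr_gt0.
have [d d0 hd] := nbhs_sqn (ch x sx _ e2).
(* If |z - x|^2 < d/4 and |y - x|^2 >= d, then [sqnB_le] gives |z - y|^2 >= d/4, and m >= 2B / (d/4)
   makes the quadratic term at least 2B. *)
have d4 : 0 < d / 4 by rewrite divr_gt0.
exists ([set z | sqn (z - x) < d / 4], [set m | 2 * B%:R / (d / 4) <= m%:R]).
  split => /=; first exact: near_sqn.
  exact: nbhs_infty_ger.
move=> [z m] [/= zx mle] sz y sy.
have hzx : `|h x - h z| <= e / 2 by apply: hd => //; lra.
have [yx|yx] := ltP (sqn (y - x)) d.
  have hxy := hd y yx sy.
  have -> : h z - h y = (h x - h y) - (h x - h z) by ring.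
  have := mulr_ge0 (ler0n R m) (sqn_ge0 (z - y)).
  by have := ler_normB (h x - h y) (h x - h z); lra.
have zy : d / 4 <= sqn (z - y).
  by have := sqnB_le y x z; rewrite (sqnC y z); lra.
have : 2 * B%:R <= m%:R * sqn (z - y).
  rewrite ler_pdivrMr// in mle; apply: le_trans mle _.
  by rewrite ler_wpM2l.
have := hB z sz; have := hB y sy.
by have := ler_normB (h z) (h y); lra.
Qed.

(** The point s = q / |q| is the point of the sphere nearest to q, so |x - s| <= |x - q| + |q - s|
    <= 2 |x - q|. For q = 0 any s will do. *)
Lemma sphere_projection q : exists2 s, sqn s = 1 &
  forall x, sqn x = 1 -> sqn (x - s) <= 4 * sqn (x - q).
Proof.
have [q0|q0] := eqVneq (sqn q) 0.
  have s1 : sqn (delta_mx 0 0) = 1.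
    rewrite /sqn (bigD1 0)//= mxE !eqxx expr1n big1 ?addr0// => i i0.
    by rewrite mxE (negbTE i0) andbF expr0n.
  exists (delta_mx 0 0) => // x sx.
  have qE : q = 0.
    apply/rowP => i; rewrite mxE; apply/eqP; rewrite -sqrf_eq0 eq_le sqr_ge0 andbT.
    by rewrite -q0; exact: coord_sq_le_sqn.
  have := sqnB_le x (delta_mx 0 0) 0.
  by rewrite qE sub0r subr0 -[- _]sub0r sqnC subr0 s1 sx; lra.
pose r := Num.sqrt (sqn q).
have r0 : 0 < r by rewrite sqrtr_gt0 lt_neqAle eq_sym q0 sqn_ge0.
pose s := r^-1 *: q.
have qE : q = r *: s by rewrite scalerA mulfV ?scale1r// gt_eqF.
have sqnZ c x : sqn (c *: x) = c ^+ 2 * sqn x.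
  by rewrite /sqn mulr_sumr; apply: eq_bigr => i _; rewrite mxE exprMn.
have s1 : sqn s = 1.
  rewrite sqnZ exprVn sqr_sqrtr ?sqn_ge0// mulVf//.
exists s => // x sx; rewrite qE.
pose c := \sum_(i < 4) x 0 i * s 0 i.
have dist t : sqn (x - t *: s) = 1 + t ^+ 2 - 2 * t * c.
  rewrite -{1}sx -[t ^+ 2]mulr1 -{1}s1 /sqn /c !mulr_sumr -big_split/= -sumrB.
  by apply: eq_bigr => i _; rewrite !mxE; ring.
have c1 : c <= 1 by have := sqn_ge0 (x - 1 *: s); rewrite dist expr1n mulr1; lra.
have c2 : -1 <= c by have := sqn_ge0 (x - (-1) *: s); rewrite dist sqrrN expr1n; lra.
rewrite -{1}(scale1r s) !dist -subr_ge0.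
have [cneg|cpos] := ltP c 0.
  have := mulr_ge0 (ltW r0) (_ : 0 <= - c); rewrite oppr_ge0 => /(_ (ltW cneg)).
  by have := sqr_ge0 r; lra.
have -> : 4 * (1 + r ^+ 2 - 2 * r * c) - (1 + 1 ^+ 2 - 2 * 1 * c) =
  4 * (r - c) ^+ 2 + 2 * ((1 - c) * (1 + 2 * c)) by ring.
have h : 0 <= (1 - c) * (1 + 2 * c) by rewrite mulr_ge0//; lra.
by have := sqr_ge0 (r - c); lra.
Qed.

Definition row4 (a b c d : R) : 'rV[R]_4 := \row_i nth 0 [:: a; b; c; d] i.

Lemma sqn_row4 a b c d : sqn (row4 a b c d) = a ^+ 2 + b ^+ 2 + c ^+ 2 + d ^+ 2.
Proof. by rewrite sqnE !mxE !inordK. Qed.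

Lemma row4B a b c d a' b' c' d' :
  row4 a b c d - row4 a' b' c' d' = row4 (a - a') (b - b') (c - c') (d - d').
Proof.
by apply/rowP => i; rewrite !mxE; case: i => -[|[|[|[|]]]].
Qed.

Lemma C2_of_row4 p :
  C2_of_R4 (row4 (complex.Re p.1) (complex.Im p.1) (complex.Re p.2) (complex.Im p.2)) = p.
Proof. by rewrite /C2_of_R4 !mxE !inordK//; case: p => -[a b] [c d]. Qed.

Lemma S3_C2_of_R4 x : S3 (C2_of_R4 x) <-> sqn x = 1.
Proof.
rewrite /S3 /= -!add_Re2_Im2/= sqnE -addrA -rmorphD/=; split.
  by move=> /(congr1 (@complex.Re R)).
by move=> ->.
Qed.

Lemma bernstein_dense (u : R[i] * R[i] -> R) :
  (forall e : R, 0 < e -> exists2 K, 0 <= K & forall x y, sqn x = 1 -> sqn y = 1 ->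
    `|u (C2_of_R4 x) - u (C2_of_R4 y)| <= e + K * sqn (x - y)) ->
  forall e : R, 0 < e -> exists2 g : R[i] * R[i] -> R, bipoly (fun p => (g p)%:C) &
    forall p, S3 p -> `|u p - g p| <= e.
Proof.
move=> umod e e0; have e2 : 0 < e / 2 by rewrite divr_gt0.
have [K K0 uK] := umod _ e2.
have /choice[pr prP] q : exists s, sqn s = 1 /\
    forall x, sqn x = 1 -> sqn (x - s) <= 4 * sqn (x - q).
  by have [s] := sphere_projection q; exists s.
pose L := 4 * K; have L0 : 0 <= L by rewrite mulr_ge0.
(* Each of the four coordinates then costs L / (n + 1) <= e / 8, in total e / 2. The factor 4 in [L]
   comes from the projection of the nodes. *)
pose n := Num.trunc (L * 8 / e); pose nd := @bern_node R n.
pose phi i j k l := u (C2_of_R4 (pr (row4 (nd i) (nd j) (nd k) (nd l)))).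
pose co (t : R) := (t + 1) / 2.
have coE t : 2 * co t - 1 = t by rewrite /co; field.
pose g p := bern (co (complex.Re p.1)) n.+1 (fun i =>
  bern (co (complex.Im p.1)) n.+1 (fun j =>
  bern (co (complex.Re p.2)) n.+1 (fun k =>
  bern (co (complex.Im p.2)) n.+1 (fun l => phi i j k l)))).
exists g.
  have bco (t : R[i] * R[i] -> R) : bipoly (fun p => (t p)%:C) ->
      bipoly (fun p => (co (t p))%:C).
    move=> bt; have := bipolyZ 2^-1 (bipolyD bt (bipoly_cst 1)).
    congr bipoly; apply/funext => p; rewrite /co.
    by rewrite realcM realcD realcV realc_nat mulrC.
  have [b1 b2] := @bipoly_coord1 R; have [b3 b4] := @bipoly_coord2 R.
  apply: bipoly_bern => [|i]; first exact: bco.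
  apply: bipoly_bern => [|j]; first exact: bco.
  apply: bipoly_bern => [|k]; first exact: bco.
  apply: bipoly_bern => [|l]; first exact: bco.
  exact: bipoly_cst.
move=> p; rewrite -(C2_of_row4 p) => /S3_C2_of_R4; rewrite C2_of_row4.
case: p => -[x1 x2] [x3 x4].
change (sqn (row4 x1 x2 x3 x4) = 1 ->
  `|u (x1 +i* x2, x3 +i* x4) - g (x1 +i* x2, x3 +i* x4)| <= e) => sx.
have sx' := sx; rewrite sqn_row4 in sx'.
have co01 t : t ^+ 2 <= 1 -> 0 <= co t <= 1.
  move=> t1; have : `|t| <= 1.
    by rewrite -(@ler_pXn2r _ 2) ?nnegrE// expr1n real_normK ?num_real.
  by rewrite ler_norml /co => /andP[? ?]; lra.
have [q1 q2] := (sqr_ge0 x1, sqr_ge0 x2); have [q3 q4] := (sqr_ge0 x3, sqr_ge0 x4).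
have c1 : 0 <= co x1 <= 1 by apply: co01; lra.
have c2 : 0 <= co x2 <= 1 by apply: co01; lra.
have c3 : 0 <= co x3 <= 1 by apply: co01; lra.
have c4 : 0 <= co x4 <= 1 by apply: co01; lra.
have uphi i j k l : `|u (x1 +i* x2, x3 +i* x4) - phi i j k l| <=
    e / 2 + L * (x1 - nd i) ^+ 2 + L * (x2 - nd j) ^+ 2 +
    L * (x3 - nd k) ^+ 2 + L * (x4 - nd l) ^+ 2.
  have [s1 sle] := prP (row4 (nd i) (nd j) (nd k) (nd l)).
  have := uK _ _ sx s1; rewrite -[u (C2_of_R4 (row4 _ _ _ _))]/(u _).
  rewrite (C2_of_row4 (x1 +i* x2, x3 +i* x4)) => /le_trans; apply.
  have := sle _ sx; rewrite row4B sqn_row4 => /(ler_wpM2l K0).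
  by rewrite /L; lra.
have [v vE ve] : exists2 v, L / n.+1%:R = v & v <= e / 8.
  exists (L / n.+1%:R) => //; rewrite ler_pdivrMr ?ltr0n//.
  have := ltW (truncnS_gt (L * 8 / e)); rewrite -/n ler_pdivrMr//.
  by move: (n.+1%:R) => w; lra.
have step C t : 0 <= co t <= 1 ->
    bern (co t) n.+1 (fun i => C + L * (t - nd i) ^+ 2) <= C + v.
  by move=> ct; have := bern_sqdist_le n C L0 ct; rewrite coE vE.
set U := u _.
(* The coordinates are averaged out one at a time, the terms of the others acting as the constant C
   of [step]. *)
have h4 i j k : `|U - bern (co x4) n.+1 (fun l => phi i j k l)| <=
    e / 2 + v + L * (x1 - nd i) ^+ 2 + L * (x2 - nd j) ^+ 2 +
    L * (x3 - nd k) ^+ 2.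
  apply: le_trans (bern_dist _ _ _ c4) _.
  apply: le_trans (bern_le _ c4 (uphi i j k)) _.
  by apply: le_trans (step _ _ c4) _; lra.
have h3 i j : `|U - bern (co x3) n.+1 (fun k => bern (co x4) n.+1
    (fun l => phi i j k l))| <=
    e / 2 + v *+ 2 + L * (x1 - nd i) ^+ 2 + L * (x2 - nd j) ^+ 2.
  apply: le_trans (bern_dist _ _ _ c3) _.
  apply: le_trans (bern_le _ c3 (h4 i j)) _.
  by apply: le_trans (step _ _ c3) _; lra.
have h2 i : `|U - bern (co x2) n.+1 (fun j => bern (co x3) n.+1 (fun k =>
    bern (co x4) n.+1 (fun l => phi i j k l)))| <=
    e / 2 + v *+ 3 + L * (x1 - nd i) ^+ 2.
  apply: le_trans (bern_dist _ _ _ c2) _.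
  apply: le_trans (bern_le _ c2 (h3 i)) _.
  by apply: le_trans (step _ _ c2) _; lra.
apply: le_trans (bern_dist _ _ _ c1) _.
apply: le_trans (bern_le _ c1 h2) _.
apply: le_trans (step _ _ c1) _.
lra.
Qed.

Lemma smooth_S3_dense (f : R[i] * R[i] -> R[i]) : smooth_S3 f ->
  forall e : R, 0 < e -> exists2 g, bipoly g & forall p, S3 p -> `|f p - g p| <= e%:C.
Proof.
move=> sf.
(* [r] is the real or the imaginary part, and the disjunction selects the matching local extension u
   or v. *)
have cont (r : R[i] -> R) : (forall u v : R, r (u +i* v) = u) \/
     (forall u v : R, r (u +i* v) = v) ->
    forall x, sqn x = 1 -> forall e : R, 0 < e -> \forall y \near x, sqn y = 1 ->
     `|r (f (C2_of_R4 x)) - r (f (C2_of_R4 y))| <= e.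
  move=> rE x /S3_C2_of_R4 Sx e e0.
  have [U [u [v [oU Ux su sv fE]]]] := sf x Sx.
  have nU : nbhs x U by exact: open_nbhs_nbhs.
  have cu : {for x, continuous u} by case: (su 0%N) => + _; exact.
  have cv : {for x, continuous v} by case: (sv 0%N) => + _; exact.
  move/cvgrPdist_le : cu => /(_ _ e0) cu; move/cvgrPdist_le : cv => /(_ _ e0) cv.
  near=> y => /S3_C2_of_R4 Sy.
  have Uy : U y by near: y.
  by rewrite !fE//; case: rE => rE; rewrite !rE; near: y.
move=> e e0; have e2 : 0 < e / 2 by rewrite divr_gt0.
have [g1 bg1 fg1] := bernstein_dense
  (u := fun p => complex.Re (f p))
  (sphere_modulus (cont (@complex.Re R) (or_introl (fun _ _ => erefl)))) e2.
have [g2 bg2 fg2] := bernstein_dense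
  (u := fun p => complex.Im (f p))
  (sphere_modulus (cont (@complex.Im R) (or_intror (fun _ _ => erefl)))) e2.
exists (fun p => (g1 p)%:C + 'i%C * (g2 p)%:C).
  exact: bipolyD bg1 (bipolyZ 'i%C bg2).
move=> p Sp; rewrite {1}[f p]complexE.
rewrite opprD addrACA -mulrBr -!realcB (le_trans (ler_normD _ _))//.
have ni : `|'i%C : R[i]| = 1 by rewrite normc_def/= expr0n expr1n add0r sqrtr1.
rewrite normrM ni mul1r !norm_realc -realcD lecR.
by have := fg1 p Sp; have := fg2 p Sp; lra.
Unshelve. all: by end_near. Qed.

End sphere.

(** * Equidistribution *)

Section equidistribution.
Context {R : realType}.
Implicit Types (N j l k m : nat) (p : R[i] * R[i]).

Lemma bimonom_conj a b c d p : (bimonom a b c d p)^*%C = bimonom b a d c p.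
Proof. by rewrite /bimonom !conjcM !conjcK; ring. Qed.

Lemma bimonomM a b c d a' b' c' d' p :
  bimonom a b c d p * bimonom a' b' c' d' p =
  bimonom (a + a') (b + b') (c + c') (d + d') p.
Proof. by rewrite /bimonom !exprD !conjcM; ring. Qed.

Lemma monom_bimonom N j p : monom N j p = bimonom j 0 (N - j) 0 p.
Proof. by rewrite /bimonom /monom !expr0 conjc1 !mulr1. Qed.

Lemma S3_L2norm_monom N j : (j <= N)%N ->
  S3_L2norm (@monom R N j) = Num.sqrt (monom_sqnorm N j).
Proof.
move=> jN; rewrite /S3_L2norm; congr Num.sqrt.
have -> : S3_Rint (fun p => ComplexField.Normc.normc (@monom R N j p) ^+ 2) =
    complex.Re (S3_int (bimonom j j (N - j) (N - j))).
  apply: S3_Rint_eq => p _.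
  have -> : bimonom j j (N - j) (N - j) p = `|@monom R N j p| ^+ 2.
    by rewrite sqr_normc monom_bimonom bimonom_conj bimonomM !addn0 !add0n.
  rewrite -add_Re2_Im2/=; case: (monom N j p) => x y /=.
  by rewrite sqr_sqrtr ?addr_ge0 ?sqr_ge0.
by rewrite S3_int_bimonom !eqxx /= /monom_sqnorm subnKC.
Qed.

Definition nmonom N j p : R[i] := monom N j p / (S3_L2norm (@monom R N j))%:C.

Lemma nmonom_bounded_measurable N j : S3_bounded_measurable (nmonom N j).
Proof.
have bm := S3_bounded_measurableM (bimonom_bounded_measurable j 0 (N - j) 0)
  (S3_bounded_measurable_cst (S3_L2norm (@monom R N j))%:C^-1).
by apply: S3_bounded_measurable_eq bm => p _; rewrite -monom_bimonom.
Qed.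

Definition moment a b c d N j l : R[i] :=
  S3_int (fun p => bimonom a b c d p * (nmonom N j p * (nmonom N l p)^*%C)).

Lemma momentE a b c d N j l : (j <= N)%N -> (l <= N)%N ->
  moment a b c d N j l =
  (if (a + j == b + l)%N && (c + (N - j) == d + (N - l))%N then
     (((a + j)`! * (c + (N - j))`!)%:R / (a + j + (c + (N - j))).+1`!%:R /
      (Num.sqrt (monom_sqnorm N j) * Num.sqrt (monom_sqnorm N l)))%:C else 0).
Proof.
move=> jN lN; rewrite -[RHS]mulr1.
pose c0 : R := (Num.sqrt (monom_sqnorm N j) * Num.sqrt (monom_sqnorm N l))^-1.
transitivity (c0%:C * S3_int (bimonom (a + j) (b + l) (c + (N - j)) (d + (N - l)))).
  rewrite -S3_intZ; last exact: bimonom_bounded_measurable.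
  apply: S3_int_eq => p _.
  have -> : bimonom (a + j) (b + l) (c + (N - j)) (d + (N - l)) p =
      bimonom a b c d p * (monom N j p * (monom N l p)^*%C).
    rewrite !monom_bimonom bimonom_conj !bimonomM.
    by rewrite !addn0 !add0n.
  rewrite /nmonom !S3_L2norm_monom// /c0 conjcM -!realcV.
  by rewrite !conjc_real invfM realcM; ring.
rewrite S3_int_bimonom mulr1 /c0; case: ifP => _; last by rewrite mulr0.
by rewrite -realcM mulrC.
Qed.

Definition rs_phase (s : nat -> R) N k j : R[i] :=
  (s j)%:C * expi (2 * pi * j%:R * k%:R / N.+1%:R).

Lemma PNkE N s k p : PNk N s k p =
  (1 / Num.sqrt N.+1%:R)%:C * \sum_(j < N.+1) rs_phase s N k j * nmonom N j p.
Proof. by rewrite /PNk big_mkord. Qed.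

Lemma PNk_bounded_measurable N s k : S3_bounded_measurable (@PNk R N s k).
Proof.
have bm := S3_bounded_measurableM
  (S3_bounded_measurable_cst (1 / Num.sqrt N.+1%:R : R)%:C)
  (@S3_bounded_measurable_sum R _ (index_enum 'I_N.+1) xpredT
    (fun (j : 'I_N.+1) p => rs_phase s N k j * nmonom N j p)
    (fun (j : 'I_N.+1) _ => S3_bounded_measurableM (S3_bounded_measurable_cst _)
       (nmonom_bounded_measurable N j))).
by apply: S3_bounded_measurable_eq bm => p _; rewrite PNkE.
Qed.

Lemma S3_int_bimonom_PNk a b c d N s k :
  S3_int (fun p => bimonom a b c d p * `|PNk N s k p| ^+ 2) =
  N.+1%:R^-1 * \sum_(j < N.+1) \sum_(l < N.+1)
    rs_phase s N k j * (rs_phase s N k l)^*%C * moment a b c d N j l.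
Proof.
have bmt j l : S3_bounded_measurable
    (fun p => bimonom a b c d p * (nmonom N j p * (nmonom N l p)^*%C)).
  apply: S3_bounded_measurableM; first exact: bimonom_bounded_measurable.
  apply: S3_bounded_measurableM; first exact: nmonom_bounded_measurable.
  exact/S3_bounded_measurable_conj/nmonom_bounded_measurable.
have bmc j l : S3_bounded_measurable (fun p =>
    rs_phase s N k j * (rs_phase s N k l)^*%C *
    (bimonom a b c d p * (nmonom N j p * (nmonom N l p)^*%C))).
  exact: S3_bounded_measurableM (S3_bounded_measurable_cst _) (bmt j l).
transitivity (S3_int (fun p => N.+1%:R^-1 * \sum_(j < N.+1) \sum_(l < N.+1)
    rs_phase s N k j * (rs_phase s N k l)^*%C *
    (bimonom a b c d p * (nmonom N j p * (nmonom N l p)^*%C)))).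
  apply: S3_int_eq => p _; rewrite PNkE normrM exprMn sqr_normc.
  have -> : (1 / Num.sqrt N.+1%:R : R)%:C * (1 / Num.sqrt N.+1%:R : R)%:C^*%C =
      N.+1%:R^-1.
    rewrite conjc_real -realcM -expr2 expr_div_n expr1n sqr_sqrtr// mul1r.
    by rewrite realcV realc_nat.
  rewrite mulrCA; congr (_ * _); rewrite sqr_normc conjc_sum mulr_suml mulr_sumr.
  apply: eq_bigr => j _; rewrite mulr_sumr mulr_sumr; apply: eq_bigr => l _.
  by rewrite [X in _ * (_ * X) = _]conjcM; ring.
rewrite S3_intZ; last by do 2 apply: S3_bounded_measurable_sum => ? _.
congr (_ * _); rewrite S3_int_sum => [|j _]; last first.
  by apply: S3_bounded_measurable_sum => l _.
apply: eq_bigr => j _; rewrite S3_int_sum => [|l _] //.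
by apply: eq_bigr => l _; rewrite S3_intZ.
Qed.

(** The factor N + 1 cancels the normalization of [PNk], and the binomial coefficient is the one of
    (|z|^2 + |w|^2)^N. *)
Lemma monom_sqnormV N j : (j <= N)%N ->
  (monom_sqnorm N j)^-1 = N.+1%:R * 'C(N, j)%:R :> R.
Proof.
move=> jN; rewrite /monom_sqnorm invf_div factS -(bin_fact jN) mulnA natrM.
by rewrite mulfK ?natrM// -natrM pnatr_eq0 muln_eq0 negb_or -!lt0n !fact_gt0.
Qed.

Lemma S3_int_bimonom_diag a c N s k : (forall j, (j <= N)%N -> s j ^+ 2 = 1) ->
  S3_int (fun p => bimonom a a c c p * `|PNk N s k p| ^+ 2) =
  S3_int (@bimonom R a a c c).
Proof.
move=> s1; rewrite S3_int_bimonom_PNk.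
have step (j : 'I_N.+1) : \sum_(l < N.+1)
    rs_phase s N k j * (rs_phase s N k l)^*%C * moment a a c c N j l =
    N.+1%:R * (('C(N, j)%:R : R)%:C *
      S3_int (bimonom (a + j) (a + j) (c + (N - j)) (c + (N - j)))).
  have jN : (j <= N)%N by rewrite -ltnS.
  rewrite (bigD1 j)//= big1 ?addr0 => [|l lj]; last first.
    rewrite momentE ?eqn_add2l -1?ltnS//.
    by rewrite eq_sym -val_eqE/= in lj; rewrite (negbTE lj) mulr0.
  have -> : rs_phase s N k j * (rs_phase s N k j)^*%C = 1.
    rewrite -sqr_normc normrM norm_expi mulr1 sqr_normc conjc_real.
    by rewrite -realcM -expr2 s1.
  rewrite mul1r momentE// !eqxx S3_int_bimonom !eqxx -realc_nat -!realcM.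
  congr (_%:C); rewrite -expr2 sqr_sqrtr ?ltW ?monom_sqnorm_gt0//.
  by rewrite monom_sqnormV//; ring.
under eq_bigr do rewrite step.
rewrite -mulr_sumr mulKf ?pnatr_eq0//.
have bmb j := bimonom_bounded_measurable (R := R)
  (a + j) (a + j) (c + (N - j)) (c + (N - j)).
transitivity (S3_int (fun p => \sum_(j < N.+1) ('C(N, j)%:R : R)%:C *
    bimonom (a + j) (a + j) (c + (N - j)) (c + (N - j)) p)).
  rewrite S3_int_sum => [|j _].
    by apply: eq_bigr => j _; rewrite S3_intZ.
  exact: S3_bounded_measurableM (S3_bounded_measurable_cst _) (bmb j).
apply: S3_int_eq => p; rewrite /S3/= !sqr_normc addrC => Sp.
have SN : (p.2 * p.2^*%C + p.1 * p.1^*%C) ^+ N = 1 by rewrite Sp expr1n.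
rewrite -[RHS]mulr1 -[X in _ = _ * X]SN exprDn mulr_sumr.
apply: eq_bigr => j _; rewrite realc_nat -bimonomM mulrCA; congr (_ * _).
by rewrite /bimonom !exprMn -!conjcX mulr_natl [in RHS]mulrC.
Qed.

Lemma S3_int_PNk_sqnorm N s k : (forall j, (j <= N)%N -> s j ^+ 2 = 1) ->
  S3_int (fun p => `|@PNk R N s k p| ^+ 2) = 1.
Proof.
move=> s1; transitivity (S3_int (@bimonom R 0 0 0 0)).
  rewrite -(S3_int_bimonom_diag 0 0 k s1); apply: S3_int_eq => p _.
  by rewrite /bimonom !expr0 conjc1 !mul1r.
by rewrite S3_int_bimonom /= !fact0 divr1.
Qed.

Lemma S3_int1 : S3_int (fun=> 1 : R[i]) = 1.
Proof.
transitivity (S3_int (@bimonom R 0 0 0 0)).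
  by apply: S3_int_eq => p _; rewrite /bimonom !expr0 conjc1 !mul1r.
by rewrite S3_int_bimonom /= !fact0 divr1.
Qed.

Lemma bimonom_norm_le1 a b c d p : S3 p -> `|bimonom a b c d p| <= 1.
Proof.
rewrite /S3/= => Sp.
have h1 : `|p.1| <= 1.
  rewrite -(@ler_pXn2r _ 2) ?nnegrE// expr1n -Sp lerDl.
  by rewrite exprn_ge0.
have h2 : `|p.2| <= 1.
  rewrite -(@ler_pXn2r _ 2) ?nnegrE// expr1n -Sp lerDr.
  by rewrite exprn_ge0.
rewrite /bimonom !normrM !normcJ !normrX.
by rewrite !mulr_ile1 ?mulr_ge0 ?exprn_ge0 ?exprn_ile1.
Qed.

Lemma S3_int_nmonom_sqnorm N j : (j <= N)%N ->
  S3_int (fun p => `|nmonom N j p| ^+ 2) = 1.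
Proof.
move=> jN; transitivity (moment 0 0 0 0 N j j).
  apply: S3_int_eq => p _.
  by rewrite /bimonom !expr0 conjc1 !mul1r sqr_normc.
rewrite momentE// !eqxx /= !add0n -expr2 sqr_sqrtr ?ltW ?monom_sqnorm_gt0//.
by rewrite subnKC// -/(monom_sqnorm N j) divff// gt_eqF// monom_sqnorm_gt0.
Qed.

(** On the sphere the integrand is at most (|e_j|^2 + |e_l|^2) / 2, whose integral is 1; the 2 is
    the factor of [S3_int_norm_le]. *)
Lemma moment_norm_le a b c d N j l : (j <= N)%N -> (l <= N)%N ->
  `|moment a b c d N j l| <= 2.
Proof.
move=> jN lN.
have bj := S3_bounded_measurable_normsq (nmonom_bounded_measurable N j).
have bl := S3_bounded_measurable_normsq (nmonom_bounded_measurable N l).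
have bjl := S3_bounded_measurableD bj bl.
have bh := S3_bounded_measurableM (S3_bounded_measurable_cst 2^-1) bjl.
have := S3_int_norm_le _ bh.
rewrite S3_intZ// S3_intD// !S3_int_nmonom_sqnorm// mulVf ?pnatr_eq0// mulr1.
apply.
  apply: S3_bounded_measurableM; first exact: bimonom_bounded_measurable.
  apply: S3_bounded_measurableM; first exact: nmonom_bounded_measurable.
  exact/S3_bounded_measurable_conj/nmonom_bounded_measurable.
move=> p Sp; rewrite normrM (le_trans (ler_wpM2r _ (bimonom_norm_le1 a b c d Sp)))//.
rewrite mul1r normrM normcJ.
move: (normr_real (nmonom N j p)) (normr_real (nmonom N l p)).
move: (`|nmonom N j p|) (`|nmonom N l p|) => x y xr yr.
rewrite [leRHS]mulrC ler_pdivlMr// -subr_ge0.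
have -> : x ^+ 2 + y ^+ 2 - x * y * 2 = (x - y) ^+ 2 by ring.
by rewrite real_exprn_even_ge0// rpredB.
Qed.

End equidistribution.

(** * Off-diagonal moments *)

Section off_diagonal.
Context {R : realType}.
Implicit Types (N j l k m : nat).

Definition rs_defect (s : nat -> nat -> R) (k : nat -> nat)
    (g : R[i] * R[i] -> R[i]) N : R[i] :=
  S3_int (fun p => g p * `|PNk N (s N) (k N) p| ^+ 2) - S3_int g.

Lemma moment_offdiag a d N m l : (l + m <= N)%N ->
  moment a (a + m) (d + m) d N (l + m) l = (monom_weight (a + m) d N m l : R)%:C.
Proof.
move=> lmN; rewrite momentE; [|lia..].
have -> : (a + (l + m) == a + m + l)%N by apply/eqP; lia.
have E : (d + m + (N - (l + m)) = d + (N - l))%N by lia.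
rewrite E eqxx /= /monom_weight [X in _ / X]mulrC.
have -> : (a + (l + m) = a + m + l)%N by lia.
by have -> : (a + m + l + (d + (N - l)) = a + m + d + N)%N by lia.
Qed.

Lemma monom_weight_le2 b d N m l : (m <= b)%N -> (l + m <= N)%N ->
  monom_weight b d N m l <= 2 :> R.
Proof.
move=> mb lmN; rewrite -(subnK mb) -lecR -moment_offdiag//.
have -> : (2%:C : R[i]) = 2 by exact: realc_nat.
have lN := leq_trans (leq_addr m l) lmN.
apply: le_trans (moment_norm_le (b - m) (b - m + m) (d + m) d lmN lN).
rewrite moment_offdiag// ger0_norm// ler0c.
exact/ltW/monom_weight_gt0.
Qed.

(** The phase of the product depends on the difference m of the indices but not on l, so it leaves
    the sum over l as a unimodular factor. This gives uniformity in k. *)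
Lemma rs_phaseM (s : nat -> R) N k m l :
  rs_phase s N k (l + m) * (rs_phase s N k l)^*%C =
  expi (2 * pi * m%:R * k%:R / N.+1%:R) * (s l * s (l + m)%N)%:C.
Proof.
rewrite /rs_phase conjcM conjc_real natrD.
have -> : 2 * pi * (l%:R + m%:R) * k%:R / N.+1%:R =
  2 * pi * l%:R * k%:R / N.+1%:R + 2 * pi * m%:R * k%:R / N.+1%:R :> R by ring.
rewrite expiD realcM.
have := sqr_normc (expi (2 * pi * l%:R * k%:R / N.+1%:R : R)).
rewrite norm_expi expr1n; set z := expi _ => z1.
transitivity (expi (2 * pi * m%:R * k%:R / N.+1%:R) * ((s l)%:C * (s (l + m)%N)%:C) *
  (z * z^*%C)); first by move: (z^*%C) => w; ring.
by rewrite -z1 mulr1.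
Qed.

Lemma S3_int_bimonom_offdiag a d m N (s : nat -> R) k : (m <= N)%N -> (0 < m)%N ->
  S3_int (fun p => bimonom a (a + m) (d + m) d p * `|PNk N s k p| ^+ 2) =
  N.+1%:R^-1 * expi (2 * pi * m%:R * k%:R / N.+1%:R) *
  (\sum_(0 <= l < (N - m).+1) s l * s (l + m)%N * monom_weight (a + m) d N m l)%:C.
Proof.
move=> mN m0; rewrite S3_int_bimonom_PNk -mulrA; congr (_ * _).
rewrite exchange_big /=.
(* Only j = l + m contributes; the value 0 stands for those l whose partner exceeds N. *)
pose F (l : nat) : R[i] := if (l + m <= N)%N then
  expi (2 * pi * m%:R * k%:R / N.+1%:R) *
   (s l * s (l + m)%N * monom_weight (a + m) d N m l)%:C else 0.
transitivity (\sum_(l < N.+1) F l).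
  apply: eq_bigr => l _.
  have lN : (l <= N)%N by rewrite -ltnS.
  have off (j : 'I_N.+1) : (j != l + m :> nat)%N ->
      moment a (a + m) (d + m) d N j l = 0 :> R[i].
    move=> jlm; have jN : (j <= N)%N by rewrite -ltnS.
    rewrite momentE// (_ : (a + j == a + m + l)%N = false)//.
    by apply/negbTE; apply: contra jlm => /eqP h; apply/eqP; lia.
  rewrite /F; case: ifPn => lm.
    have jlt : (l + m < N.+1)%N by rewrite ltnS.
    rewrite (bigD1 (Ordinal jlt))//= big1 ?addr0 => [|j jne]; last first.
      by rewrite off ?mulr0//; rewrite -val_eqE/= in jne.
    by rewrite moment_offdiag// rs_phaseM -mulrA -realcM.
  apply: big1 => j _; rewrite off ?mulr0//.
  by apply: contra lm => /eqP <-; rewrite -ltnS.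
rewrite -(big_mkord xpredT F) (big_cat_nat (n := (N - m).+1))//=; last first.
  by rewrite ltnS leq_subr.
rewrite [X in _ + X]big_nat [X in _ + X]big1 ?addr0 => [|l]; last first.
  by rewrite /F => /andP[h _]; case: ifPn => //; lia.
have -> : (\sum_(0 <= l < (N - m).+1)
      s l * s (l + m)%N * monom_weight (a + m) d N m l)%:C =
  \sum_(0 <= l < (N - m).+1) (s l * s (l + m)%N * monom_weight (a + m) d N m l)%:C.
  exact: rmorph_sum.
rewrite mulr_sumr big_nat [RHS]big_nat; apply: eq_bigr => l /andP[_ lNm].
by rewrite /F (_ : (l + m <= N)%N)//; lia.
Qed.

Lemma rs_defect_offdiag (s : nat -> nat -> R) (k : nat -> nat) a d m : 
  (forall N, rudin_shapiro N (s N)) -> (0 < m)%N ->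
  forall e : R, 0 < e -> exists N0, forall N, (N0 <= N)%N ->
    `|rs_defect s k (bimonom a (a + m) (d + m) d) N| <= e%:C.
Proof.
move=> hs m0 e e0.
(* The final bound is 3 (2 m q) 2 / (N + 1) = 12 m q / (N + 1), with 2^q <= 2 (N + 1). *)
have em : 0 < e / (12 * m)%:R by rewrite divr_gt0// ltr0n muln_gt0.
have [N0 hN0] := log_over_linear em.
exists (maxn N0 m) => N; rewrite geq_max => /andP[N0N mN].
have [q [qN s1 corr_le]] := rudin_shapiroP (hs N).
rewrite /rs_defect S3_int_bimonom ifF; last first.
  by apply/negbTE/negP => /andP[/eqP h _]; lia.
rewrite subr0 S3_int_bimonom_offdiag// !normrM norm_expi mulr1.
rewrite -realc_nat -realcV !norm_realc -realcM lecR ger0_norm ?invr_ge0//.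
have sumle : `|\sum_(0 <= l < (N - m).+1) s N l * s N (l + m)%N *
    monom_weight (a + m) d N m l| <= 3 * ((2 * m * q)%:R * 2).
  apply: unimodal_sum_le => [l lNm|l lNm|j jNm].
  - by rewrite ltW ?monom_weight_gt0//= monom_weight_le2 ?leq_addl//; lia.
  - by apply: monom_weight_unimodal; [exact: leq_addl|lia].
  - by apply: corr_le => //; lia.
rewrite mulrC ler_pdivrMr//; apply: le_trans sumle _.
have := hN0 N q N0N qN; rewrite ler_pdivrMr// mulrAC ler_pdivlMr ?ltr0n ?muln_gt0//.
by rewrite !natrM; move: (N.+1%:R) => w; lra.
Qed.

End off_diagonal.

(** * Passage from monomials to smooth functions *)

Section main.
Context {R : realType}.
Variables (s : nat -> nat -> R) (k : nat -> nat).
Hypothesis hs : forall N : nat, rudin_shapiro N (s N).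
Local Notation defect := (rs_defect s k).

Let s_sq N j : (j <= N)%N -> s N j ^+ 2 = 1.
Proof. by have [m [_ + _]] := rudin_shapiroP (hs N); exact. Qed.

Let P_bm N := PNk_bounded_measurable N (s N) (k N).

Let Psq_bm N := S3_bounded_measurable_normsq (P_bm N).

Let vanishing (u : nat -> R[i]) := forall e : R, 0 < e -> exists N0,
  forall N, (N0 <= N)%N -> `|u N| <= e%:C.

Lemma rs_defectD g h N : S3_bounded_measurable g -> S3_bounded_measurable h ->
  defect (fun p => g p + h p) N = defect g N + defect h N.
Proof.
move=> bg bh; rewrite /rs_defect S3_intD//.
rewrite (S3_int_eq (h := fun p => g p * `|PNk N (s N) (k N) p| ^+ 2 +
  h p * `|PNk N (s N) (k N) p| ^+ 2)); last by move=> p _; rewrite mulrDl.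
by rewrite S3_intD; [rewrite opprD addrACA|exact: S3_bounded_measurableM..].
Qed.

Lemma rs_defectZ c g N : S3_bounded_measurable g ->
  defect (fun p => c * g p) N = c * defect g N.
Proof.
move=> bg; rewrite /rs_defect S3_intZ// mulrBr; congr (_ - _).
rewrite -S3_intZ; last exact: S3_bounded_measurableM.
by apply: S3_int_eq => p _; rewrite mulrA.
Qed.

Lemma rs_defect_conj g N : S3_bounded_measurable g ->
  defect (fun p => (g p)^*%C) N = (defect g N)^*%C.
Proof.
move=> bg; rewrite /rs_defect.
have conjcB (z w : R[i]) : (z - w)^*%C = z^*%C - w^*%C by exact: rmorphB.
rewrite conjcB S3_int_conj//; congr (_ - _).
rewrite -S3_int_conj; last exact: S3_bounded_measurableM.
have conj_sqr (z : R[i]) : (`|z| ^+ 2)^*%C = `|z| ^+ 2.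
  by rewrite sqr_normc conjcM conjcK mulrC.
by apply: S3_int_eq => p _; rewrite conjcM conj_sqr.
Qed.

Lemma rs_defect_bimonom a b c d : vanishing (defect (bimonom a b c d)).
Proof.
(* Adding a + j = b + l and c + (N - j) = d + (N - l) gives a + c = b + d. If this fails, every
   moment vanishes and the defect is 0 for all N. *)
have [abcd|abcd] := eqVneq (a + c)%N (b + d)%N; last first.
  move=> e e0; exists 0%N => N _; rewrite /rs_defect S3_int_bimonom.
  rewrite ifF; last by apply/negbTE; apply: contra abcd => /andP[/eqP-> /eqP->].
  rewrite subr0 S3_int_bimonom_PNk big1 ?mulr0 ?normr0 ?ler0c ?ltW// => j _.
  apply: big1 => l _; rewrite momentE -1?ltnS// ifF ?mulr0//.
  apply/negbTE; apply: contra abcd => /andP[/eqP h1 /eqP h2].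
  have := ltn_ord j; have := ltn_ord l; lia.
have [ab|ba|ab] := ltngtP a b.
- have -> : b = (a + (b - a))%N by lia.
  have -> : c = (d + (b - a))%N by lia.
  by apply: rs_defect_offdiag => //; lia.
- move=> e e0; have [|N0 hN0] := @rs_defect_offdiag R s k b c (a - b) hs _ e e0.
    by lia.
  exists N0 => N N0N; have := hN0 N N0N.
  rewrite -normcJ -rs_defect_conj; last exact: bimonom_bounded_measurable.
  congr (`|defect _ N| <= _); apply/funext => p; rewrite bimonom_conj.
  by congr bimonom; lia.
- have cd : c = d by lia.
  move=> e e0; exists 0%N => N _; rewrite /rs_defect -ab -cd S3_int_bimonom_diag.
    by rewrite subrr normr0 ler0c ltW.
  exact: s_sq.
Qed.

Lemma rs_defect_bipoly g : bipoly g -> vanishing (defect g).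
Proof.
elim=> [a b c d|f1 f2 bf1 h1 bf2 h2|c f1 bf1 h1].
- exact: rs_defect_bimonom.
- move=> e e0; have e2 : 0 < e / 2 by rewrite divr_gt0.
  have [N1 hN1] := h1 _ e2; have [N2 hN2] := h2 _ e2.
  exists (maxn N1 N2) => N; rewrite geq_max => /andP[N1N N2N].
  rewrite rs_defectD; try exact: bipoly_bounded_measurable.
  rewrite (le_trans (ler_normD _ _))// [e]splitr realcD.
  by apply: lerD; [exact: hN1|exact: hN2].
- move=> e e0; have cnorm : `|c| = (ComplexField.Normc.normc c)%:C by case: c.
  have n0 : 0 <= ComplexField.Normc.normc c by rewrite -ler0c -cnorm.
  set C := ComplexField.Normc.normc c in cnorm n0.
  (* C + 1 instead of C, as c may be 0. *)
  have ec : 0 < e / (C + 1) by rewrite divr_gt0// ltr_wpDl.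
  have [N1 hN1] := h1 _ ec; exists N1 => N N1N.
  rewrite rs_defectZ; last exact: bipoly_bounded_measurable.
  rewrite normrM (le_trans (ler_wpM2l _ (hN1 N N1N)))//.
  rewrite cnorm -realcM lecR mulrCA ler_piMr ?ltW//.
  by rewrite ltr_pdivrMr ?ltr_wpDl// mul1r ltrDl.
Qed.

Lemma rs_defect_smooth f : smooth_S3 f -> vanishing (defect f).
Proof.
move=> sf.
have bf : S3_bounded_measurable f.
  apply: S3_bounded_measurable_lim => e /(smooth_S3_dense sf)[g bg fg].
  by exists g => //; exact: bipoly_bounded_measurable.
(* The defect of f - g consists of two integrals, each at most 2 (e / 5), and the defect of g takes
   the last fifth. *)
move=> e e0; have e5 : 0 < e / 5 by rewrite divr_gt0.
have [g bg fg] := smooth_S3_dense sf e5.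
have [N0 hN0] := rs_defect_bipoly bg e5.
have bmg := bipoly_bounded_measurable bg.
have bfg : S3_bounded_measurable (fun p => f p - g p).
  have := S3_bounded_measurableD bf
    (S3_bounded_measurableM (S3_bounded_measurable_cst (-1)) bmg).
  by apply: S3_bounded_measurable_eq => p _; rewrite mulN1r.
exists N0 => N N0N.
have -> : defect f N = defect (fun p => f p - g p) N + defect g N.
  rewrite -rs_defectD//; congr (defect _ N); apply/funext => p.
  by rewrite subrK.
have d1 : `|S3_int (fun p => (f p - g p) * `|PNk N (s N) (k N) p| ^+ 2)| <=
    2 * (e / 5)%:C.
  have -> : (e / 5)%:C = S3_int (fun p => (e / 5)%:C * `|PNk N (s N) (k N) p| ^+ 2).
    by rewrite S3_intZ// S3_int_PNk_sqnorm ?mulr1//; exact: s_sq.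
  apply: S3_int_norm_le.
  - exact: S3_bounded_measurableM.
  - exact: S3_bounded_measurableM (S3_bounded_measurable_cst _) _.
  - move=> p Sp; rewrite normrM [X in _ * X]ger0_norm ?exprn_ge0//.
    by rewrite ler_wpM2r ?exprn_ge0// fg.
have d2 : `|S3_int (fun p => f p - g p)| <= 2 * (e / 5)%:C.
  have -> : (e / 5)%:C = S3_int (fun p : R[i] * R[i] => (e / 5)%:C * 1).
    by rewrite (S3_intZ _ (S3_bounded_measurable_cst 1)) S3_int1 mulr1.
  apply: S3_int_norm_le => //.
    exact: S3_bounded_measurableM (S3_bounded_measurable_cst _)
      (S3_bounded_measurable_cst _).
  by move=> p Sp; rewrite mulr1 fg.
rewrite (le_trans (ler_normD _ _))// (le_trans (lerD (ler_normB _ _) (hN0 N N0N)))//.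
rewrite (le_trans (lerD (lerD d1 d2) (lexx _)))//.
rewrite -[2](realc_nat 2) -!realcM.
by rewrite -!realcD lecR; lra.
Qed.

End main.

Unset Implicit Arguments.
Set Strict Implicit.
Set Printing Implicit Defensive.

Theorem theorem3 (R : realType) (s : nat -> nat -> R)
    (hs : forall N : nat, rudin_shapiro N (s N))
    (f : R[i] * R[i] -> R[i]) (hf : smooth_S3 f)
    (k : nat -> nat) (hk : forall N : nat, (k N <= N)%N) :
  (fun N : nat => S3_int (fun p => f p * `|PNk N (s N) (k N) p| ^+ 2) : R[i]^o) @ \oo
    --> (S3_int f : R[i]^o).
Proof.
apply/cvgrPdist_le => e e0.
(* The radius is an element of [R[i]]; being positive, it is real. *)
have eR : e = (complex.Re e)%:C by rewrite RRe_real// gtr0_real.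
have e1 : 0 < complex.Re e by rewrite -ltcR -eR.
have [N0 hN0] := rs_defect_smooth k hs hf e1.
exists N0 => // N /= N0N; rewrite distrC eR; exact: hN0.
Qed.
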